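(* The space of $GL_5$-invariants $(Q\mathscr P_5)_8^{GL_5}$ is trivial (zero), where $GL_5=GL(5,\mathbb Z/2)$.
   Context: Let $\mathcal A_2$ be the mod 2 Steenrod algebra and $\mathcal A_2^+$ its augmentation ideal. Let $\mathscr P_d=\mathbb Z/2[x_1,\dots,x_d]$ with each $x_i$ of degree 1, regarded as a left $\mathcal A_2$-module by $Sq^1(x_i)=x_i^2$, $Sq^k(x_i)=0$ for $k>1$, and the Cartan formula. Put $Q\mathscr P_d=\mathscr P_d/\mathcal A_2^+\mathscr P_d$, with degree-$n$ component $(Q\mathscr P_d)_n$. The group $GL_d=GL(d,\mathbb Z/2)$ acts on $\mathscr P_d$ by linear substitution of the variables: for $w=(w_{ij})\in GL_d$, $x_j\mapsto \sum_{i}w_{ij}x_i$. This commutes with the $\mathcal A_2$-action, so $GL_d$ acts on each $(Q\mathscr P_d)_n$; $(Q\mathscr P_d)_n^{GL_d}$ denotes the subspace of invariants. *)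

(* Defs.v *)
From HB Require Import structures.
From mathcomp Require Import all_boot all_algebra ring_quotient zify.
From mathcomp Require Import finmap boolp.
From mathcomp Require Import -(notations) monalg.
From mathcomp Require Import mpoly.

Import GRing.Theory.

(* The coefficient 'C(b - 1 - j, a - 2j) of the Adem relation, extended to pairs
   with 2b <= a <= 2b + 1 so that the relation becomes a tautology there. *)
Definition adem_coef a b j : nat :=
  if 2 * j <= a then if j < b then 'C(b.-1 - j, a - 2 * j) else 1 else 0.

Lemma leq_or_gt m n : m <= n \/ n < m.
Proof. by apply/orP; rewrite leqNgt orNb. Qed.

Lemma adem_coef_out a b j : a < 2 * j -> adem_coef a b j = 0.
Proof. by rewrite /adem_coef ltnNge => /negbTE->. Qed.
Lemma adem_coef_in a b j : 2 * j <= a -> j < b -> adem_coef a b j = 'C(b.-1 - j, a - 2 * j).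
Proof. by rewrite /adem_coef => -> ->. Qed.
Lemma adem_coef_top a b j : 2 * j <= a -> b <= j -> adem_coef a b j = 1.
Proof. by rewrite /adem_coef ltnNge => -> ->. Qed.

Lemma adem_coef_pascal a b j : a <= 2 * b ->
  odd (adem_coef a.+1 b.+1 j + adem_coef a.+1 b.+1 j.+1) = odd (adem_coef a b.+1 j + adem_coef a.+1 b j).
Proof.
move=> le_ab; case: (ltngtP j b) => hjb.
- have [le_ja|lt_aj] := leqP (2 * j) a.+1; last by rewrite !adem_coef_out //; lia.
  have [e|ne] := eqVneq (2 * j) a.+1.
    rewrite (adem_coef_out a.+1 b.+1 j.+1) ?(adem_coef_out a b.+1 j) ?adem_coef_in; try lia.
    by rewrite e subnn !bin0.
  rewrite !(adem_coef_in _ _ j) //; try lia.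
  have [e|ne'] := eqVneq (2 * j) a.
    rewrite (adem_coef_out _ _ j.+1); last by lia.
    have [k -> ->] : exists2 k, b.+1.-1 - j = k.+1 & b.-1 - j = k by exists (b - j.+1); lia.
    have -> : a.+1 - 2 * j = 1 by lia.
    by rewrite e subnn !bin0 !bin1 addn0 add1n.
  rewrite (adem_coef_in _ _ j.+1); try lia.
  have [k [-> -> ->]] : exists k, [/\ b.+1.-1 - j = k.+1, b.+1.-1 - j.+1 = k & b.-1 - j = k].
    by exists (b - j.+1); split; lia.
  have [l [-> -> ->]] : exists l, [/\ a.+1 - 2 * j = l.+2, a - 2 * j = l.+1 & a.+1 - 2 * j.+1 = l].
    by exists (a - 2 * j - 1); split; lia.
  by rewrite !binS; congr odd; lia.
- by rewrite !adem_coef_out //; lia.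
subst j; rewrite (adem_coef_out _ _ b.+1); last by lia.
have [lt_ab|le_ba] := ltnP a.+1 (2 * b); first by rewrite !adem_coef_out //; lia.
rewrite (adem_coef_top a.+1 b b) // (adem_coef_in a.+1) // subnn.
have [e|ne] := eqVneq a (2 * b).
  by rewrite e adem_coef_in // subSnn !subnn.
rewrite adem_coef_out; last by lia.
by have -> : a.+1 - 2 * b = 0 by lia.
Qed.


Set Implicit Arguments.
Unset Strict Implicit.
Unset Printing Implicit Defensive.

Local Open Scope ring_scope.
Local Open Scope quotient_scope.

(* The total square f |-> \sum_k Sq^k(f) T^k. The Cartan formula says that it
   is multiplicative, and on generators it is x_i |-> x_i + x_i^2 T. *)
Definition total_sq (d : nat) : {mpoly 'F_2[d]} -> {poly {mpoly 'F_2[d]}} :=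
  mmap (polyC \o @mpolyC d 'F_2)
       (fun i : 'I_d => ('X_i : {mpoly 'F_2[d]})%:P
                        + (('X_i : {mpoly 'F_2[d]}) ^+ 2)%:P * 'X).

HB.lock Definition Sq (d k : nat) (f : {mpoly 'F_2[d]}) : {mpoly 'F_2[d]} :=
  (total_sq f)`_k.
Canonical Sq_unlockable := Unlockable Sq.unlock.

Section PolynomialSquares.
Variable d : nat.
Local Notation P := {mpoly 'F_2[d]}.

Implicit Types (f g : P) (i : 'I_d).

HB.instance Definition _ := GRing.RMorphism.on (@total_sq d).

Lemma SqE k (f : P) : Sq k f = (total_sq f)`_k.
Proof. by rewrite unlock. Qed.

Lemma Sq_is_additive k : zmod_morphism (@Sq d k).
Proof. by move=> f g; rewrite !SqE raddfB coefB. Qed.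
HB.instance Definition _ k :=
  GRing.isZmodMorphism.Build P P (@Sq d k) (Sq_is_additive k).

Lemma SqD k f g : Sq k (f + g) = Sq k f + Sq k g.
Proof. exact: raddfD. Qed.

Lemma SqZ k c f : Sq k (c *: f) = c *: Sq k f.
Proof.
by rewrite !SqE -mul_mpolyC rmorphM /= /total_sq mmapC /= coefCM mul_mpolyC.
Qed.

Lemma Sq_cartan k f g :
  Sq k (f * g) = \sum_(i < k.+1) Sq i f * Sq (k - i) g.
Proof. by rewrite SqE rmorphM coefM; apply: eq_bigr => i _; rewrite !SqE. Qed.

Lemma total_sqX i :
  total_sq 'X_i = ('X_i)%:P + (('X_i : P) ^+ 2)%:P * 'X.
Proof. by rewrite /total_sq mmapX mmap1U. Qed.

Lemma Sq1_X i : Sq 1 'X_i = 'X_i ^+ 2.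
Proof. by rewrite !SqE total_sqX coefD coefC coefMX coefC add0r. Qed.

Lemma Sqk_X k i : (1 < k)%N -> Sq k 'X_i = 0.
Proof. by case: k => [|[|k]] // _; rewrite !SqE total_sqX coefD coefC coefMX coefC addr0. Qed.

Lemma Sq_1 k : Sq k (1 : P) = (k == 0%N)%:R.
Proof. by rewrite !SqE rmorph1 coef1. Qed.

Lemma mpoly_ind_mul (Q : P -> Prop) :
  (forall f g, Q f -> Q g -> Q (f + g)) -> (forall c f, Q f -> Q (c *: f)) ->
  Q 1 -> (forall i f, Q f -> Q ('X_i * f)) -> forall f, Q f.
Proof.
move=> QD QZ Q1 QX f; have QM m : Q 'X_[m].
  rewrite mpolyXE_id; elim/big_rec: _ => // i g _ Qg.
  by elim: (m i) => [|k IHk]; rewrite ?expr0 ?mul1r // exprS -mulrA; apply: QX.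
rewrite [f]mpolyE; elim/big_rec: _ => [|m g _ Qg]; last exact/QD/Qg/QZ/QM.
by rewrite -[0](scale0r 1); apply: QZ.
Qed.

Lemma Sq0 f : Sq 0 f = f.
Proof.
elim/mpoly_ind_mul: f => [f g Hf Hg|c f Hf||i f Hf].
- by rewrite raddfD /= Hf Hg.
- by rewrite SqZ Hf.
- exact: Sq_1.
- by rewrite !SqE rmorphM /= total_sqX coef0M coefD coefC coefMX addr0 -SqE Hf.
Qed.

Local Definition Sq' k f := if k is k'.+1 then Sq k' f else 0.

Lemma Sq_XM k i f : Sq k ('X_i * f) = 'X_i * Sq k f + 'X_i ^+ 2 * Sq' k f.
Proof.
rewrite !SqE rmorphM /= total_sqX mulrDl coefD coefCM -mulrA coefCM coefXM.
by case: k => [|k] //=; rewrite SqE.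
Qed.

Lemma addff (f : P) : f + f = 0.
Proof. by rewrite -mulr2n -scaler_nat (_ : 2%:R = 0) ?scale0r //; apply/val_inj. Qed.

Lemma mulrn_odd (f : P) n : f *+ n = f *+ odd n.
Proof. by rewrite -{1}[n]odd_double_half mulrnDr -muln2 mulrnA mulr2n addff addr0. Qed.

Lemma Sq_XXM k i f : Sq k ('X_i ^+ 2 * f)
  = 'X_i ^+ 2 * Sq k f + 'X_i ^+ 4 * (if k is k'.+2 then Sq k' f else 0).
Proof.
rewrite {1}expr2 -mulrA !Sq_XM; case: k => [|k] /=; rewrite ?Sq_XM.
  by rewrite !mulr0 !addr0 mulrA -expr2.
rewrite !mulrDr addrA -(addrA (_ * _)) [X in _ + X + _](_ : _ = 0).
  rewrite addr0 (exprD _ 2 2) -!mulrA (mulrA 'X_i) -expr2.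
  by case: k => [|k]; rewrite //= !mulr0.
by rewrite mulrCA addff.
Qed.

Lemma Sq_Sq_XM k j i f : Sq k.+1 (Sq j ('X_i * f)) =
  'X_i * Sq k.+1 (Sq j f) + 'X_i ^+ 2 * (Sq k (Sq j f) + Sq k.+1 (Sq' j f))
  + 'X_i ^+ 4 * (if k is k'.+1 then Sq k' (Sq' j f) else 0).
Proof. by rewrite Sq_XM raddfD /= Sq_XM Sq_XXM mulrDr !addrA. Qed.

Let mulrnD3 (x y z p q r s : P) n :
  (x * p + y * (q + r) + z * s) *+ n
  = x * (p *+ n) + y * (q *+ n + r *+ n) + z * (s *+ n).
Proof. by rewrite !mulrnDl -!mulrnAr mulrnDl. Qed.

Let eq_mulrn (u v : P) n : (n <> 0%N -> u = v) -> u *+ n = v *+ n.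
Proof. by case: n => [|n] // ->. Qed.

Local Notation c := adem_coef.
Let R a b N f := \sum_(j < N) Sq (a + b - j) (Sq j f) *+ c a b j.

Let R0 b N f : R 0 b N.+1 f = Sq b f.
Proof.
rewrite /R big_ord_recl /= subn0 Sq0 big1 ?addr0 => [|j _]; last first.
  by rewrite adem_coef_out.
case: b => [|b]; first by rewrite adem_coef_top.
by rewrite adem_coef_in // bin0.
Qed.

Let R_top a b N f : (2 * b <= a <= (2 * b).+1)%N -> (a./2 < N)%N ->
  R a b N f = Sq a (Sq b f).
Proof.
move=> hab haN; have ltbN : (b < N)%N by lia.
rewrite /R (bigD1 (Ordinal ltbN)) //= big1 ?addr0 => [|j].
  by rewrite addnK adem_coef_top //; lia.
rewrite -val_eqE /= => ne_jb; have [h|h] := leq_or_gt (2 * j) a; last by rewrite adem_coef_out.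
by rewrite adem_coef_in ?bin_small ?mulr0n //; lia.
Qed.

Let R_X a b N i f : (a <= 2 * b)%N -> (a.+1 < 2 * N)%N ->
  R a.+1 b.+1 N ('X_i * f) = 'X_i * R a.+1 b.+1 N f
    + 'X_i ^+ 2 * (R a b.+1 N f + R a.+1 b N f)
    + 'X_i ^+ 4 * (if a is a'.+1 then R a' b N f else 0).
Proof.
move=> le_ab lt_aN.
pose T2 j := Sq (a + b.+1 - j) (Sq j f) *+ c a.+1 b.+1 j.
pose T3 j := Sq (a.+1 + b.+1 - j) (Sq' j f) *+ c a.+1 b.+1 j.
pose T4 j := (if (a.+1 + b.+1 - j)%N is k.+2 then Sq k (Sq' j f) else 0)
             *+ c a.+1 b.+1 j.
have shift (T : nat -> P) : T N = 0 ->
    \sum_(j < N) T j = T 0%N + \sum_(j < N) T j.+1.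
  move=> TN; rewrite -(big_ord_recl _ (fun j : 'I_N.+1 => T j)).
  by rewrite big_ord_recr /= TN addr0.
have c0 := @adem_coef_out a.+1 b.+1.
have -> : R a.+1 b.+1 N ('X_i * f) = 'X_i * R a.+1 b.+1 N f
    + 'X_i ^+ 2 * (\sum_(j < N) T2 j + \sum_(j < N) T3 j)
    + 'X_i ^+ 4 * \sum_(j < N) T4 j.
  rewrite -big_split /= !mulr_sumr -!big_split /=; apply: eq_bigr => j _.
  rewrite /T2 /T3 /T4 -mulrnD3; apply: eq_mulrn => /eqP; rewrite -lt0n => hc.
  have h : (2 * j <= a.+1)%N by case: (leq_or_gt (2 * j) a.+1) => // /c0 e; rewrite e in hc.
  have -> : (a.+1 + b.+1 - j = (a + b.+1 - j).+1)%N by lia.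
  exact: Sq_Sq_XM.
have -> : \sum_(j < N) T2 j + \sum_(j < N) T3 j = R a b.+1 N f + R a.+1 b N f.
  rewrite (shift T3); last by rewrite /T3 c0.
  rewrite {1}/T3 /= raddf0 mul0rn add0r -!big_split; apply: eq_bigr => j _ /=.
  rewrite /T2 /T3 /=.
  have -> : (a.+1 + b.+1 - j.+1 = a + b.+1 - j)%N by lia.
  have -> : (a.+1 + b - j = a + b.+1 - j)%N by lia.
  rewrite -!mulrnDr.
  by rewrite mulrn_odd adem_coef_pascal // -mulrn_odd.
congr (_ + 'X_i ^+ 4 * _); rewrite (shift T4); last by rewrite /T4 c0.
have -> : T4 0%N = 0 by rewrite /T4 subn0 addSn addnS raddf0 mul0rn.
rewrite add0r; case: a => [|a] in le_ab lt_aN c0 @T2 @T3 @T4 *.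
  by rewrite big1 // => j _; rewrite /T4 c0 //=; lia.
apply: eq_bigr => j _; rewrite /T4.
have [h|h] := leq_or_gt (2 * j.+1) a.+2; last by rewrite c0 // adem_coef_out //; lia.
have -> : (a.+2 + b.+1 - j.+1 = (a + b - j).+2)%N by lia.
congr (_ *+ _); rewrite !adem_coef_in; try lia.
by congr 'C(_, _); lia.
Qed.

Lemma Sq_adem a b f : (a < 2 * b)%N ->
  Sq a (Sq b f) =
  \sum_(j < a./2.+1) Sq (a + b - j) (Sq j f) *+ 'C(b - 1 - j, a - 2 * j).
Proof.
move=> lt_ab; suff: forall a b N, (a <= (2 * b).+1)%N -> (a./2 < N)%N -> Sq a (Sq b f) = R a b N f.
  move=> hR; rewrite (hR a b a./2.+1 (leqW (ltnW lt_ab)) (leqnn _)); apply: eq_bigr => j _.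
  by have := ltn_ord j => hj; rewrite adem_coef_in ?subn1 //; lia.
elim/mpoly_ind_mul: f {a b lt_ab} => [f g Hf Hg|c0 f Hf||i f Hf] a b N hab hN.
- rewrite !SqD (Hf _ _ _ hab hN) (Hg _ _ _ hab hN) /R -big_split.
  apply: eq_bigr => j _.
  by rewrite !SqD mulrnDl.
- rewrite !SqZ (Hf _ _ _ hab hN) scaler_sumr; apply: eq_bigr => j _.
  by rewrite !SqZ scalerMnr.
- have [le_ba|lt_ab] := leq_or_gt (2 * b) a; first by rewrite R_top ?le_ba.
  have -> : Sq b (1 : P) = 0 by rewrite Sq_1 (_ : (b == 0)%N = false) //; lia.
  rewrite raddf0 /R big1 // => j _; rewrite Sq_1.
  case: eqP => [->|_]; last by rewrite raddf0 mul0rn.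
  by rewrite subn0 Sq_1 (_ : (a + b == 0)%N = false) ?mul0rn //; lia.
have [le_ba|lt_ab] := leq_or_gt (2 * b) a; first by rewrite R_top ?le_ba.
case: a => [|a] in hab hN lt_ab *; first by case: N hN => // N _; rewrite R0 Sq0.
case: b => [//|b] in hab lt_ab *.
rewrite R_X; try lia.
rewrite Sq_Sq_XM -!Hf; try lia.
congr (_ + _ * _).
by case: a lt_ab hab hN => [|a] lt_ab hab hN //; rewrite -Hf //; lia.
Qed.

End PolynomialSquares.

Local Notation F := (malg (fmonom nat) 'F_2).

(* Free generators Sq^k, k >= 0; the relation Sq^0 = 1 is imposed below. *)
Definition free_sq (k : nat) : F := mkmalgU (fmu k) 1.

Definition adem_relator (a b : nat) : F :=
  free_sq a * free_sq b
  - \sum_(j < a./2.+1)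
      (free_sq (a + b - j) * free_sq j) *+ 'C(b - 1 - j, a - 2 * j).

(* The two-sided ideal of relations of the Steenrod algebra. *)
Inductive adem_span : F -> Prop :=
| adem_span_unit : adem_span (free_sq 0 - 1)
| adem_span_rel a b : (0 < a < 2 * b)%N -> adem_span (adem_relator a b)
| adem_span_0 : adem_span 0
| adem_span_B x y : adem_span x -> adem_span y -> adem_span (x - y)
| adem_span_Ml z x : adem_span x -> adem_span (z * x)
| adem_span_Mr z x : adem_span x -> adem_span (x * z).

Definition adem_ideal : {pred F} := fun x => `[< adem_span x >].

Lemma adem_idealP x : reflect (adem_span x) (x \in adem_ideal).
Proof. exact: asboolP. Qed.

Lemma adem_ideal_zmod : zmod_closed adem_ideal.
Proof.
split=> [|x y /adem_idealP hx /adem_idealP hy]; apply/adem_idealP.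
  exact: adem_span_0.
exact: adem_span_B.
Qed.
HB.instance Definition _ := GRing.isZmodClosed.Build F adem_ideal adem_ideal_zmod.

(* 1 on words in Sq^0 only, 0 on words with a factor Sq^k, k > 0. *)
Definition free_aug_word (m : fmonom nat) : 'F_2 := (all (pred1 0%N) m)%:R.

Lemma free_aug_word_mmorphism : monalg.mmorphism free_aug_word.
Proof.
split=> [x y|]; rewrite /free_aug_word ?fmM ?fm1 //.
by rewrite all_cat -natrM mulnb.
Qed.
HB.instance Definition _ :=
  monalg.isMultiplicative.Build (fmonom nat) 'F_2 free_aug_word
    free_aug_word_mmorphism.

Definition free_aug : F -> 'F_2 := monalg.mmap idfun free_aug_word.
HB.instance Definition _ := GRing.RMorphism.on free_aug.

Lemma free_aug_sq k : free_aug (free_sq k) = (k == 0%N)%:R.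
Proof. by rewrite /free_aug monalg.mmapU mul1r /free_aug_word fmU /= andbT. Qed.

Lemma free_aug_ideal x : adem_span x -> free_aug x = 0.
Proof.
elim=> {x} [|a b hab||x y _ hx _ hy|z x _ hx|z x _ hx].
- by rewrite rmorphB rmorph1 /= free_aug_sq subrr.
- have -> : free_aug (adem_relator a b) =
      free_aug (free_sq a) * free_aug (free_sq b) - \sum_(j < a./2.+1)
      (free_aug (free_sq (a + b - j)) * free_aug (free_sq j))
        *+ 'C(b - 1 - j, a - 2 * j).
    rewrite rmorphB rmorphM (raddf_sum free_aug); congr (_ - _).
    by apply: eq_bigr => j _; rewrite -rmorphM -raddfMn.
  have a0 : (a == 0)%N = false by lia.
  rewrite !free_aug_sq a0 mul0r sub0r big1 ?oppr0 // => j _.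
  have hj := ltn_ord j; have ab0 : (a + b - j == 0)%N = false by lia.
  by rewrite free_aug_sq ab0 mul0r mul0rn.
- by rewrite raddf0.
- by rewrite raddfB /= hx hy subrr.
- by rewrite rmorphM /= hx mulr0.
- by rewrite rmorphM /= hx mul0r.
Qed.

(* The mod 2 Steenrod algebra. *)
Definition A2 := Quotient.quot adem_ideal.
HB.instance Definition _ := GRing.Zmodule.on A2.
HB.instance Definition _ := EqQuotient.on A2.

HB.lock Definition A2_class (x : F) : A2 := \pi_A2 x.

Lemma A2_eqP (x y : F) : A2_class x = A2_class y <-> adem_span (x - y).
Proof.
rewrite A2_class.unlock (rwP (@adem_idealP (x - y))) Quotient.idealrBE.
exact: (rwP eqP).
Qed.

Lemma A2_reprK (u : A2) : A2_class (repr u) = u.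
Proof. by rewrite A2_class.unlock reprK. Qed.

Lemma A2_elim (T : A2 -> Prop) : (forall x, T (A2_class x)) -> forall u, T u.
Proof. by move=> hT u; rewrite -[u]A2_reprK. Qed.

Lemma A2_classB : zmod_morphism A2_class.
Proof. by move=> x y; rewrite A2_class.unlock raddfB. Qed.
HB.instance Definition _ := GRing.isZmodMorphism.Build F A2 A2_class A2_classB.

Definition A2_one : A2 := A2_class 1.
Definition A2_mul (x y : A2) : A2 := A2_class (repr x * repr y).

Lemma A2_mul_class (x y : F) : A2_mul (A2_class x) (A2_class y) = A2_class (x * y).
Proof.
apply/A2_eqP; set x' := repr _; set y' := repr _.
have hx : adem_span (x' - x) by apply/A2_eqP; rewrite A2_reprK.
have hy : adem_span (y - y') by apply/A2_eqP; rewrite A2_reprK.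
rewrite (_ : _ - _ = (x' - x) * y' - x * (y - y')); last first.
  by rewrite mulrBl mulrBr opprB addrA subrK.
exact/adem_span_B/adem_span_Ml/hy/adem_span_Mr.
Qed.

Fact A2_mulA : associative A2_mul.
Proof.
elim/A2_elim=> x; elim/A2_elim=> y; elim/A2_elim=> z.
by rewrite !A2_mul_class mulrA.
Qed.

Fact A2_mul1 : left_id A2_one A2_mul.
Proof. by elim/A2_elim=> x; rewrite A2_mul_class mul1r. Qed.

Fact A2_1mul : right_id A2_one A2_mul.
Proof. by elim/A2_elim=> x; rewrite A2_mul_class mulr1. Qed.

Fact A2_mulDl : left_distributive A2_mul +%R.
Proof.
elim/A2_elim=> x; elim/A2_elim=> y; elim/A2_elim=> z.
by rewrite -raddfD !A2_mul_class mulrDl raddfD.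
Qed.

Fact A2_mulDr : right_distributive A2_mul +%R.
Proof.
elim/A2_elim=> x; elim/A2_elim=> y; elim/A2_elim=> z.
by rewrite -raddfD !A2_mul_class mulrDr raddfD.
Qed.

Fact A2_1neq0 : A2_one != 0.
Proof.
apply/eqP; rewrite -(raddf0 A2_class) => /A2_eqP/free_aug_ideal/eqP.
by rewrite subr0 rmorph1 oner_eq0.
Qed.

HB.instance Definition _ := GRing.Zmodule_isNzRing.Build A2
  A2_mulA A2_mul1 A2_1mul A2_mulDl A2_mulDr A2_1neq0.

Lemma A2_class_monoid : monoid_morphism A2_class.
Proof. by split=> [|x y]; [exact: erefl | exact/esym/A2_mul_class]. Qed.
HB.instance Definition _ :=
  GRing.isMonoidMorphism.Build F A2 A2_class A2_class_monoid.

Definition A2_sq (k : nat) : A2 := A2_class (free_sq k).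

(* The augmentation A2 -> F_2, with kernel the augmentation ideal. *)
Definition A2_aug (theta : A2) : 'F_2 := free_aug (repr theta).

Lemma A2_aug_class x : A2_aug (A2_class x) = free_aug x.
Proof.
apply/eqP; rewrite -subr_eq0 -(raddfB free_aug); apply/eqP/free_aug_ideal/A2_eqP.
exact: A2_reprK.
Qed.

Lemma A2_aug_zmod : zmod_morphism A2_aug.
Proof.
elim/A2_elim=> x; elim/A2_elim=> y.
by rewrite -raddfB !A2_aug_class (raddfB free_aug).
Qed.
HB.instance Definition _ := GRing.isZmodMorphism.Build A2 'F_2 A2_aug A2_aug_zmod.

Lemma A2_aug_monoid : monoid_morphism A2_aug.
Proof.
split=> [|]; first by rewrite -(rmorph1 A2_class) A2_aug_class rmorph1.
elim/A2_elim=> x; elim/A2_elim=> y.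
by rewrite -rmorphM !A2_aug_class (rmorphM free_aug).
Qed.
HB.instance Definition _ := GRing.isMonoidMorphism.Build A2 'F_2 A2_aug A2_aug_monoid.

Definition A2_plus : {pred A2} := [pred theta | A2_aug theta == 0].

Lemma A2_sq0 : A2_sq 0 = 1.
Proof. by rewrite -(rmorph1 A2_class); apply/A2_eqP/adem_span_unit. Qed.

Lemma A2_adem a b : (0 < a < 2 * b)%N -> A2_sq a * A2_sq b =
  \sum_(j < a./2.+1) (A2_sq (a + b - j) * A2_sq j) *+ 'C(b - 1 - j, a - 2 * j).
Proof.
move=> hab; under eq_bigr do rewrite -rmorphM -raddfMn.
by rewrite -rmorphM -(raddf_sum A2_class); apply/A2_eqP/adem_span_rel.
Qed.

Lemma A2_sq_plus k : (A2_sq k \in A2_plus) = (0 < k)%N.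
Proof. by rewrite inE A2_aug_class free_aug_sq; case: k. Qed.

Section Action.
Variable d : nat.
Local Notation P := {mpoly 'F_2[d]}.

Definition sq_word (m : fmonom nat) (f : P) : P :=
  foldr (fun k g => Sq k g) f m.

Definition free_act (x : F) (f : P) : P :=
  \sum_(m <- monalg.msupp x) monalg.mcoeff m x *: sq_word m f.

Lemma sq_wordB m : zmod_morphism (sq_word m).
Proof.
by rewrite /sq_word; elim: (m : seq nat) => //= k s IHs f g; rewrite IHs raddfB.
Qed.
HB.instance Definition _ m := GRing.isZmodMorphism.Build P P (sq_word m) (sq_wordB m).

Lemma sq_wordZ m c f : sq_word m (c *: f) = c *: sq_word m f.
Proof.
by rewrite /sq_word; elim: (m : seq nat) => //= k s ->; rewrite SqZ.
Qed.

Lemma free_actEw (D : {fset (fmonom nat)}) x f : (monalg.msupp x `<=` D)%fset ->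
  free_act x f = \sum_(m <- D) monalg.mcoeff m x *: sq_word m f.
Proof.
move=> le; rewrite [LHS](big_fset_incl _ le) => //= m _ /monalg.mcoeff_outdom ->.
by rewrite scale0r.
Qed.

Lemma free_actBl f : zmod_morphism (free_act^~ f).
Proof.
move=> x y; pose D := (monalg.msupp x `|` monalg.msupp y `|` monalg.msupp (x - y))%fset.
have hx : (monalg.msupp x `<=` D)%fset by rewrite /D -fsetUA fsubsetUl.
have hy : (monalg.msupp y `<=` D)%fset by rewrite /D fsetUAC fsubsetUr.
have hxy : (monalg.msupp (x - y) `<=` D)%fset by rewrite /D fsubsetUr.
rewrite !(free_actEw _ hx, free_actEw _ hy, free_actEw _ hxy) -sumrB.
by apply: eq_bigr => m _; rewrite monalg.mcoeffB scalerBl.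
Qed.

Local Definition free_act_at f x := free_act x f.
HB.instance Definition _ f :=
  GRing.isZmodMorphism.Build F P (free_act_at f) (free_actBl f).

Lemma free_act0l f : free_act 0 f = 0.
Proof. exact: (raddf0 (free_act_at f)). Qed.

Lemma free_act_suml I (r : seq I) (x : I -> F) f :
  free_act (\sum_(i <- r) x i) f = \sum_(i <- r) free_act (x i) f.
Proof. exact: (raddf_sum (free_act_at f)). Qed.

Lemma free_actMnl x n f : free_act (x *+ n) f = free_act x f *+ n.
Proof. exact: (raddfMn (free_act_at f)). Qed.

Lemma free_actBr x : zmod_morphism (free_act x).
Proof.
by move=> f g; rewrite -sumrB; apply: eq_bigr => m _; rewrite raddfB scalerBr.
Qed.
HB.instance Definition _ x :=
  GRing.isZmodMorphism.Build P P (free_act x) (free_actBr x).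

Lemma free_actU c m f : free_act (mkmalgU m c) f = c *: sq_word m f.
Proof. by rewrite (free_actEw _ monalg.msuppU_le) big_seq_fset1 monalg.mcoeffUU. Qed.

Lemma free_act_sq k f : free_act (free_sq k) f = Sq k f.
Proof. by rewrite free_actU scale1r /sq_word fmU. Qed.

Lemma free_act1 f : free_act 1 f = f.
Proof. by rewrite free_actU scale1r /sq_word fm1. Qed.

Lemma free_actM x y f : free_act (x * y) f = free_act x (free_act y f).
Proof.
rewrite monalg.malgME free_act_suml [RHS]/free_act; apply: eq_bigr => m1 _.
rewrite free_act_suml [free_act y f]/free_act raddf_sum scaler_sumr.
apply: eq_bigr => m2 _; rewrite free_actU /= sq_wordZ scalerA; congr (_ *: _).
by rewrite /sq_word fmM foldr_cat.
Qed.

Lemma free_act_ideal x f : adem_span x -> free_act x f = 0.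
Proof.
move=> hx; elim: hx f => {x} [|a b /andP[_ hab]||x y _ hx _ hy|z x _ hx|z x _ hx] f.
- by rewrite free_actBl free_act1 free_act_sq Sq0 subrr.
- rewrite free_actBl free_actM !free_act_sq Sq_adem // free_act_suml.
  apply/eqP; rewrite subr_eq0; apply/eqP/eq_bigr => j _.
  by rewrite free_actMnl free_actM !free_act_sq.
- exact: free_act0l.
- by rewrite free_actBl hx hy subrr.
- by rewrite free_actM hx raddf0.
- by rewrite free_actM hx.
Qed.

(* The left A2-module structure of P; A2_act_class, A2_actM and the neighbouring
   lemmas show that it is well defined and satisfies the module laws. *)
Definition A2_act (theta : A2) (f : P) : P := free_act (repr theta) f.

Lemma A2_act_class x f : A2_act (A2_class x) f = free_act x f.
Proof.
apply/eqP; rewrite -subr_eq0 -free_actBl; apply/eqP/free_act_ideal/A2_eqP.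
exact: A2_reprK.
Qed.

Lemma A2_act_sq k f : A2_act (A2_sq k) f = Sq k f.
Proof. by rewrite A2_act_class free_act_sq. Qed.

Lemma A2_act1 f : A2_act 1 f = f.
Proof. by rewrite -(rmorph1 A2_class) A2_act_class free_act1. Qed.

Lemma A2_actM x y f : A2_act (x * y) f = A2_act x (A2_act y f).
Proof.
elim/A2_elim: x => x; elim/A2_elim: y => y.
by rewrite -rmorphM !A2_act_class free_actM.
Qed.

Lemma A2_actBl f : zmod_morphism (A2_act^~ f).
Proof.
elim/A2_elim=> x; elim/A2_elim=> y.
by rewrite -raddfB !A2_act_class free_actBl.
Qed.

Lemma A2_actBr x : zmod_morphism (A2_act x).
Proof. exact: free_actBr. Qed.
HB.instance Definition _ x :=
  GRing.isZmodMorphism.Build P P (A2_act x) (A2_actBr x).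

End Action.

Section HitQuotient.
Variable d : nat.
Local Notation P := {mpoly 'F_2[d]}.

(* A2^+ P, the subspace spanned by the theta f with theta in A2^+. *)
Definition hit : {pred P} := fun f =>
  `[< exists2 r : seq (A2 * P), all (fun t => t.1 \in A2_plus) r
                              & f = \sum_(t <- r) A2_act t.1 t.2 >].

Lemma hit_zmod : zmod_closed hit.
Proof.
split=> [|f g /asboolP[r hr ->] /asboolP[s hs ->]]; apply/asboolP.
  by exists [::]; rewrite ?big_nil.
exists (r ++ [seq (t.1, - t.2) | t <- s]).
  by rewrite all_cat hr all_map /=; apply: sub_all hs.
rewrite big_cat big_map -sumrN; congr (_ + _).
by apply: eq_bigr => t _; rewrite /= raddfN.
Qed.
HB.instance Definition _ := GRing.isZmodClosed.Build P hit hit_zmod.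

Definition QP := Quotient.quot hit.
HB.instance Definition _ := GRing.Zmodule.on QP.
HB.instance Definition _ := EqQuotient.on QP.

End HitQuotient.

HB.lock Definition QP_class (d : nat) (f : {mpoly 'F_2[d]}) : QP d := \pi_(QP d) f.

(* x_j |-> \sum_i w_ij x_i *)
HB.lock Definition lin_subst (d : nat) (w : 'M['F_2]_d) (f : {mpoly 'F_2[d]}) :
    {mpoly 'F_2[d]} :=
  f \mPo [tuple \sum_(i < d) w i j *: 'X_i | j < d].

Section LinearGroupAction.
Variable d : nat.
Local Notation P := {mpoly 'F_2[d]}.
Implicit Types (f g : P) (w v : 'M['F_2]_d) (u : QP d).

Lemma QP_eqP f g : QP_class f = QP_class g <-> f - g \in @hit d.
Proof. by rewrite QP_class.unlock Quotient.idealrBE; exact: (rwP eqP). Qed.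

Lemma QP_reprK u : QP_class (repr u) = u.
Proof. by rewrite QP_class.unlock reprK. Qed.

Lemma QP_elim (T : QP d -> Prop) : (forall f, T (QP_class f)) -> forall u, T u.
Proof. by move=> hT u; rewrite -[u]QP_reprK. Qed.

Lemma QP_classB : zmod_morphism (@QP_class d).
Proof. by move=> f g; rewrite QP_class.unlock raddfB. Qed.
HB.instance Definition _ :=
  GRing.isZmodMorphism.Build P (QP d) (@QP_class d) QP_classB.

Lemma lin_substX w (j : 'I_d) : lin_subst w 'X_j = \sum_(i < d) w i j *: 'X_i.
Proof. by rewrite lin_subst.unlock comp_mpolyXU -tnth_nth tnth_mktuple. Qed.

Lemma lin_substB w : zmod_morphism (lin_subst w).
Proof. by move=> f g; rewrite lin_subst.unlock comp_mpolyB. Qed.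
HB.instance Definition _ w :=
  GRing.isZmodMorphism.Build P P (lin_subst w) (lin_substB w).

Lemma lin_subst_monoid w : monoid_morphism (lin_subst w).
Proof. by split=> [|f g]; rewrite lin_subst.unlock ?comp_mpoly1 ?rmorphM. Qed.
HB.instance Definition _ w :=
  GRing.isMonoidMorphism.Build P P (lin_subst w) (lin_subst_monoid w).

Lemma lin_substZ w c f : lin_subst w (c *: f) = c *: lin_subst w f.
Proof. by rewrite lin_subst.unlock comp_mpolyZ. Qed.

Lemma F2_sqr (c : 'F_2) : c ^+ 2 = c.
Proof. by apply/val_inj; case: c => [[|[|]]]. Qed.

Lemma mpolyF2_sqrD (f g : P) : (f + g) ^+ 2 = f ^+ 2 + g ^+ 2.
Proof. by rewrite sqrrD mulr2n addff addr0. Qed.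

Lemma lin_subst_sqX w j : (lin_subst w 'X_j) ^+ 2 = \sum_(i < d) w i j *: 'X_i ^+ 2.
Proof.
rewrite lin_substX (big_morph (fun f : P => f ^+ 2) mpolyF2_sqrD (expr0n _ 2)).
by apply: eq_bigr => i _; rewrite exprZn F2_sqr.
Qed.

Lemma lin_subst_Sq w k f : lin_subst w (Sq k f) = Sq k (lin_subst w f).
Proof.
elim/mpoly_ind_mul: f k => [f g Hf Hg|c f Hf||j f Hf] k.
- by rewrite !raddfD /= Hf Hg.
- by rewrite !(SqZ, lin_substZ) Hf.
- by rewrite rmorph1 !Sq_1 rmorph_nat.
rewrite rmorphM /= !Sq_cartan rmorph_sum; apply: eq_bigr => i _.
rewrite rmorphM /= Hf; congr (_ * _); case: i => [[|[|i]] _] /=.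
- by rewrite !Sq0.
- rewrite Sq1_X rmorphXn /= lin_subst_sqX lin_substX raddf_sum.
  by apply: eq_bigr => l _; rewrite /= SqZ Sq1_X.
rewrite Sqk_X // raddf0 lin_substX raddf_sum big1 // => l _.
by rewrite /= SqZ Sqk_X // scaler0.
Qed.

Lemma lin_subst_A2 w theta f : lin_subst w (A2_act theta f) = A2_act theta (lin_subst w f).
Proof.
rewrite /A2_act /free_act rmorph_sum; apply: eq_bigr => m _.
rewrite /= lin_substZ; congr (_ *: _).
by rewrite /sq_word; elim: (m : seq nat) => //= k s <-; rewrite lin_subst_Sq.
Qed.

Lemma lin_subst_hit w f : f \in @hit d -> lin_subst w f \in @hit d.
Proof.
case/asboolP=> r hr ->; apply/asboolP.
exists [seq (t.1, lin_subst w t.2) | t <- r]; first by rewrite all_map.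
by rewrite big_map rmorph_sum; apply: eq_bigr => t _; rewrite /= lin_subst_A2.
Qed.

(* The action induced on the quotient; it does not depend on the choice of the
   representative by QP_act_class. *)
Definition QP_act (w : 'M['F_2]_d) (u : QP d) : QP d :=
  QP_class (lin_subst w (repr u)).

Lemma QP_act_class w f : QP_act w (QP_class f) = QP_class (lin_subst w f).
Proof.
by apply/QP_eqP; rewrite -raddfB; apply/lin_subst_hit/QP_eqP/QP_reprK.
Qed.

Lemma lin_subst1 f : lin_subst 1%:M f = f.
Proof.
elim/mpoly_ind_mul: f => [f g Hf Hg|c f Hf||j f Hf].
- by rewrite raddfD /= Hf Hg.
- by rewrite lin_substZ Hf.
- by rewrite rmorph1.
rewrite rmorphM /= Hf lin_substX (bigD1 j) //= mxE eqxx scale1r.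
rewrite big1 ?addr0 // => i /negbTE ne_ij.
by rewrite mxE ne_ij scale0r.
Qed.

Lemma lin_substM w v f : lin_subst (w *m v) f = lin_subst w (lin_subst v f).
Proof.
elim/mpoly_ind_mul: f => [f g Hf Hg|c f Hf||j f Hf].
- by rewrite !raddfD /= Hf Hg.
- by rewrite !lin_substZ Hf.
- by rewrite !rmorph1.
rewrite !rmorphM /= Hf !lin_substX; congr (_ * _); rewrite raddf_sum /=.
under [RHS]eq_bigr do rewrite lin_substZ lin_substX scaler_sumr.
rewrite exchange_big; apply: eq_bigr => i _ /=; rewrite mxE scaler_suml.
by apply: eq_bigr => k _; rewrite scalerA mulrC.
Qed.

Lemma QP_act1 u : QP_act 1%:M u = u.
Proof. by elim/QP_elim: u => f; rewrite QP_act_class lin_subst1. Qed.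

Lemma QP_actM w v u : QP_act (w *m v) u = QP_act w (QP_act v u).
Proof. by elim/QP_elim: u => f; rewrite !QP_act_class lin_substM. Qed.

(* (QP_d)_n *)
Definition QP_homog (n : nat) (u : QP d) : Prop :=
  exists2 f : P, f \is n.-homog & u = QP_class f.

(* GL_d is the group of invertible matrices over F_2. *)
Definition QP_GL_invariant (n : nat) (u : QP d) : Prop :=
  QP_homog n u /\ forall w, w \in unitmx -> QP_act w u = u.

End LinearGroupAction.

(* Main.v *)
From HB Require Import structures.
Require Import Defs.
From mathcomp Require Import all_boot all_algebra ring_quotient fingroup perm.
From mathcomp Require Import boolp.
From mathcomp Require Import -(notations) monalg.
From mathcomp Require Import mpoly.
Import GRing.Theory.
Set Implicit Arguments.
Unset Strict Implicit.
Unset Printing Implicit Defensive.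
Local Open Scope ring_scope.

(* A functional psi on polynomials that annihilates every Sq^k(g) with k > 0 factors through
   QP_5, hence takes equal values at f and at w f when the class of f is GL_5-invariant: the
   functional psi o w - psi vanishes at f. Taking for w the transvection x_0 |-> x_0 + x_1,
   eight explicit psi already suffice: the functionals obtained from their differences by
   permuting variables span the dual of (QP_5)_8, so that all coordinates of f with respect
   to a monomial basis of (QP_5)_8 are zero. Steenrod squares preserve the set of variables
   occurring in a monomial and commute with permutations, so the basis and the reduction of
   the other monomials to it are needed only for monomials in the first k variables with all
   k exponents positive. *)

(** * Formal sums modulo 2 *)

(* Lists stand for sums over F_2, so this says that the sum is formally zero. *)
Definition even_mult (T : eqType) (l : seq T) : bool :=
  all (fun s => ~~ odd (count_mem s l)) l.

Lemma sum_even_mult (T : eqType) (V : nmodType) (e : T -> V) (l : seq T) :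
  (forall v : V, v + v = 0) -> even_mult l -> \sum_(s <- l) e s = 0.
Proof.
move=> V2 /allP hl; rewrite -big_undup_iterop_count big1_seq // => s /andP[_].
rewrite mem_undup => /hl /negbTE ev; rewrite Monoid.iteropE iter_addr_0.
by rewrite -[count_mem s l]odd_double_half ev -muln2 mulrnA mulr2n V2.
Qed.

(** Since minus equals plus in characteristic 2, two formal sums agree when their concatenation
    cancels; each computed certificate below has this form. *)
Lemma sum_even_mult_cat (T : eqType) (V : zmodType) (e : T -> V) (l1 l2 : seq T) :
  (forall v : V, v + v = 0) -> even_mult (l1 ++ l2) ->
  \sum_(s <- l1) e s = \sum_(s <- l2) e s.
Proof.
move=> V2 /(sum_even_mult e V2)/eqP; rewrite big_cat addr_eq0 => /eqP->.
by apply/eqP; rewrite eq_sym -addr_eq0 V2.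
Qed.

Lemma addF2 (c : 'F_2) : c + c = 0.
Proof. by apply/val_inj; case: c => [[|[|]]]. Qed.

(** * Exponent lists and coefficient functionals *)

Section Monomials.
Variable d : nat.
Local Notation P := {mpoly 'F_2[d]}.
Implicit Types (s n : seq nat) (psi : seq (seq nat)) (f : P).

(** Exponents are plain lists so that they can be computed with. Missing entries default to 0 and
    entries past d are ignored, so only lists of length d represent monomials faithfully. *)
Definition mon s : 'X_{1..d} := [multinom nth 0%N s i | i < d].
Definition mono s : P := 'X_[mon s].
Definition ev psi f : 'F_2 := \sum_(n <- psi) f@_(mon n).

Lemma mon_inj s n : size s = d -> size n = d -> (mon s == mon n) = (s == n).
Proof.
move=> hs hn; apply/eqP/eqP => [e|-> //]; apply: (@eq_from_nth _ 0%N); first by rewrite hs hn.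
move=> i; rewrite hs => hi; have := congr1 (fun m : 'X_{1..d} => m (Ordinal hi)) e.
by rewrite !mnmE.
Qed.

Lemma mon_surj (m : 'X_{1..d}) : exists2 s, size s = d & m = mon s.
Proof.
exists [seq m i | i <- enum 'I_d]; first by rewrite size_map size_enum_ord.
apply/mnmP=> i; rewrite mnmE (nth_map i) ?size_enum_ord ?ltn_ord //.
by rewrite nth_ord_enum.
Qed.

Lemma mono_coef s n : size s = d -> size n = d -> (mono s)@_(mon n) = (s == n)%:R.
Proof. by move=> hs hn; rewrite mcoeffX mon_inj. Qed.

Lemma ev_is_additive psi : zmod_morphism (ev psi).
Proof. by move=> f g; rewrite -sumrB; apply: eq_bigr => n _; rewrite mcoeffB. Qed.
HB.instance Definition _ psi :=
  GRing.isZmodMorphism.Build P 'F_2 (ev psi) (ev_is_additive psi).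

Lemma evZ psi c f : ev psi (c *: f) = c * ev psi f.
Proof. by rewrite mulr_sumr; apply: eq_bigr => n _; rewrite mcoeffZ. Qed.

Lemma ev_cat psi1 psi2 f : ev (psi1 ++ psi2) f = ev psi1 f + ev psi2 f.
Proof. exact: big_cat. Qed.

Lemma ev_flatten (r : seq (seq (seq nat))) f : ev (flatten r) f = \sum_(psi <- r) ev psi f.
Proof. exact: big_flatten. Qed.

Lemma ev_mono psi s : size s = d -> all (fun n => size n == d) psi ->
  ev psi (mono s) = (count_mem s psi)%:R.
Proof.
move=> hs /allP hpsi; rewrite -sum1_count natr_sum [RHS]big_mkcond; apply: eq_big_seq => n hn.
by rewrite mono_coef // ?(eqP (hpsi _ hn)) // eq_sym /=; case: eqP.
Qed.

(** [fwd] lists the columns of the matrix of L in the monomial basis and [bwd] those of its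
    transpose, so composing a functional with L amounts to applying [bwd] to its list. *)
Lemma ev_adjoint (L : {additive P -> P}) (fwd bwd : seq nat -> seq (seq nat)) :
  (forall c f, L (c *: f) = c *: L f) ->
  (forall s, size s = d -> L (mono s) = \sum_(t <- fwd s) mono t) ->
  (forall s, size s = d -> all (fun t => size t == d) (fwd s)) ->
  (forall s, size s = d -> all (fun t => size t == d) (bwd s)) ->
  (forall s n, count_mem n (fwd s) = count_mem s (bwd n)) ->
  forall psi f, all (fun n => size n == d) psi ->
  ev psi (L f) = ev (flatten (map bwd psi)) f.
Proof.
move=> LZ Lmono fwd_d bwd_d adj psi f hpsi; rewrite [f]mpolyE !raddf_sum /=.
apply: eq_bigr => m _; rewrite LZ !evZ; congr (_ * _).
have [s hs ->] := mon_surj m; rewrite -/(mono s) Lmono // ev_flatten big_map raddf_sum /=.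
(* Expanded into matrix entries, the double sum can be exchanged: for fixed n, the sum over t counts
   n in [fwd s]. *)
rewrite [LHS](_ : _ = \sum_(t <- fwd s) \sum_(n <- psi) (t == n)%:R).
  rewrite exchange_big; apply: eq_big_seq => n /(allP hpsi)/eqP hn /=.
  rewrite ev_mono ?bwd_d // -adj -sum1_count natr_sum [RHS]big_mkcond.
  by apply: eq_bigr => t _ /=; case: eqP.
apply: eq_big_seq => t /(allP (fwd_d _ hs))/eqP ht; apply: eq_big_seq => n /(allP hpsi)/eqP hn.
exact: mono_coef.
Qed.

End Monomials.

(** * Steenrod squares on exponent lists and their transposes *)

(* The monomials of Sq^k(x^s), by the Cartan formula and Sq^j(x^a) = C(a, j) x^(a + j). *)
Fixpoint sqs (k : nat) (s : seq nat) : seq (seq nat) :=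
  if s is a :: s' then
    flatten [seq map (cons (a + j)%N) (sqs (k - j) s') | j <- iota 0 k.+1 & odd 'C(a, j)]
  else if k is 0 then [:: [::]] else [::].

(** Transpose of [sqs k]: x^b receives C(b - j, j) times the coefficient of x^(b - j). *)
Fixpoint dsq (k : nat) (n : seq nat) : seq (seq nat) :=
  if n is b :: n' then
    flatten [seq map (cons (b - j)%N) (dsq (k - j) n')
            | j <- iota 0 k.+1 & (j <= b)%N && odd 'C(b - j, j)]
  else if k is 0 then [:: [::]] else [::].

Lemma count_mem_cons_map (T : eqType) (x y : T) (s : seq T) (l : seq (seq T)) :
  count_mem (y :: s) (map (cons x) l) = ((x == y) * count_mem s l)%N.
Proof.
rewrite count_map; have [->|ne] := eqVneq x y.
  by rewrite mul1n; apply: eq_count => t; rewrite /= eqseq_cons eqxx.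
by rewrite (eq_count (a2 := pred0)) ?count_pred0 // => t; rewrite /= eqseq_cons (negbTE ne).
Qed.

Lemma count_flatten_filter (T : eqType) (I : Type) (a : pred T) (F : I -> seq T) (Q : pred I) r :
  count a (flatten [seq F j | j <- r & Q j]) = (\sum_(j <- r) Q j * count a (F j))%N.
Proof.
rewrite count_flatten sumnE !big_map big_filter big_mkcond; apply: eq_bigr => j _.
by case: (Q j); rewrite ?mul1n.
Qed.

(** Both recursions choose j from the same range, so the counts agree term by term: for first
    exponents a and b, the term j contributes to either side only if a + j = b. *)
Lemma count_sqs_dsq k m n : count_mem n (sqs k m) = count_mem m (dsq k n).
Proof.
elim: m n k => [|a m IHm] [|b n] k.
- by [].
- rewrite [dsq _ _]/dsq -/dsq count_flatten_filter big1 => [|j _]; first by case: k.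
  by rewrite [X in (_ * X)%N]count_map (eq_count (a2 := pred0)) ?count_pred0 ?muln0.
- rewrite [sqs _ _]/sqs -/sqs count_flatten_filter big1 => [|j _]; first by case: k.
  by rewrite [X in (_ * X)%N]count_map (eq_count (a2 := pred0)) ?count_pred0 ?muln0.
rewrite /sqs -/sqs /dsq -/dsq !count_flatten_filter; apply: eq_bigr => j _.
rewrite !count_mem_cons_map IHm !mulnA; congr (_ * _)%N; rewrite !mulnb; congr nat_of_bool.
have [<-|ne] := eqVneq (a + j)%N b; first by rewrite leq_addl addnK eqxx andbT.
rewrite andbF; apply/esym/negbTE; apply: contra ne => /andP[/andP[le_jb _] /eqP <-].
by rewrite subnK.
Qed.

Lemma size_sqs k s : all (fun t => size t == size s) (sqs k s).
Proof.
elim: s k => [|a s IHs] k; first by case: k.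
apply/allP=> t /flatten_mapP[j _ /mapP[t' ht' ->]].
by rewrite /= eqSS (allP (IHs _) _ ht').
Qed.

Lemma size_dsq k s : all (fun t => size t == size s) (dsq k s).
Proof.
elim: s k => [|a s IHs] k; first by case: k.
apply/allP=> t /flatten_mapP[j _ /mapP[t' ht' ->]].
by rewrite /= eqSS (allP (IHs _) _ ht').
Qed.

(** The transposed square lowers the total degree by k, which is impossible below degree k. *)
Lemma dsq_nil k n : (sumn n < k)%N -> dsq k n = [::].
Proof.
elim: n k => [|b n IHn] k; first by case: k.
move=> lt_k; have IH j : (j <= b)%N -> dsq (k - j) n = [::].
  move=> le_jb; apply: IHn; rewrite ltn_subRL; apply: leq_ltn_trans lt_k.
  by rewrite leq_add2r.
rewrite /dsq -/dsq; elim: (iota _ _) => //= j r IHr.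
by case: ifP => // /andP[/IH e _]; rewrite /= e.
Qed.

(** * Functionals annihilating the hit polynomials *)

Section Squares.
Variable d : nat.
Local Notation P := {mpoly 'F_2[d]}.
Implicit Types (s n : seq nat) (psi : seq (seq nat)) (f g : P).

Lemma Sq_Xn k (i : 'I_d) a : Sq k ('X_i ^+ a : P) = 'X_i ^+ (a + k) *+ 'C(a, k).
Proof.
elim: a k => [|a IHa] k.
  rewrite expr0 Sq_1 bin0n add0n; case: k => [|k] //=.
rewrite exprS Sq_XM IHa; case: k => [|k] /=.
  by rewrite mulr0 !addr0 !bin0 -exprS.
rewrite IHa binS mulrnDr !mulrnAr -exprS -exprD; congr (_ *+ _ + _ *+ _).
by rewrite add2n addSn addnS.
Qed.

(** Allowing any list of variables lets the Cartan formula peel them off one at a time. *)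
Lemma Sq_monomial (l : seq 'I_d) k s : size l = size s ->
  Sq k (\prod_(p <- zip l s) 'X_(p.1) ^+ p.2 : P)
  = \sum_(t <- sqs k s) \prod_(p <- zip l t) 'X_(p.1) ^+ p.2.
Proof.
elim: l s k => [|i l IHl] [|a s] k // => [_|[hs]].
  by rewrite /= big_nil Sq_1; case: k => [|k]; rewrite ?big_seq1 ?big_nil.
rewrite [zip _ _]/= big_cons Sq_cartan [sqs _ _]/sqs -/sqs.
rewrite big_flatten big_map big_filter big_mkcond.
rewrite -(big_mkord xpredT (fun j => Sq j ('X_i ^+ a : P) *
            Sq (k - j) (\prod_(p <- zip l s) 'X_p.1 ^+ p.2))).
rewrite /index_iota subn0; apply: eq_bigr => j _; rewrite Sq_Xn IHl // mulrn_odd.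
case: odd; last by rewrite mul0r.
rewrite big_map mulr_sumr; apply: eq_bigr => t _.
by rewrite big_cons.
Qed.

Lemma mono_prod s : size s = d ->
  mono d s = \prod_(p <- zip (enum 'I_d) s) 'X_(p.1) ^+ p.2.
Proof.
move=> hs; rewrite /mono mpolyXE_id.
have {2}-> : s = [seq nth 0%N s i | i <- map val (enum 'I_d)].
  by rewrite val_enum_ord -hs -/(mkseq _ _) mkseq_nth.
rewrite -map_comp -[X in zip X _]map_id zip_map big_map big_enum /=.
by apply: eq_bigr => i _; rewrite mnmE.
Qed.

Lemma Sq_mono k s : size s = d -> Sq k (mono d s) = \sum_(t <- sqs k s) mono d t.
Proof.
move=> hs; rewrite mono_prod // Sq_monomial ?size_enum_ord //.
apply: eq_big_seq => t /(allP (size_sqs _ _))/eqP ht.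
by rewrite mono_prod ?ht.
Qed.

Lemma ev_Sq k psi f : all (fun n => size n == d) psi ->
  ev psi (Sq k f) = ev (flatten (map (dsq k) psi)) f.
Proof.
move=> hpsi; apply: (ev_adjoint (fwd := sqs k)) => //.
- exact: SqZ.
- exact: Sq_mono.
- by move=> s <-; exact: size_sqs.
- by move=> s <-; exact: size_dsq.
exact: count_sqs_dsq.
Qed.

Definition degree_mono N s : bool := (size s == d) && (sumn s == N).

(** A decidable criterion: squares with k > N need no test, because their transposes are empty in
    degree N. *)
Definition annihilates N psi : bool :=
  all (degree_mono N) psi && all (fun k => even_mult (flatten (map (dsq k) psi))) (iota 1 N).

Lemma annihilates_Sq N psi k f : annihilates N psi -> (0 < k)%N -> ev psi (Sq k f) = 0.
Proof.
case/andP=> /allP hdeg /allP hN k_gt0; rewrite ev_Sq; last first.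
  by apply/allP=> s /hdeg/andP[].
have [le_kN|lt_Nk] := leqP k N.
  by apply: sum_even_mult addF2 _; apply: hN; rewrite mem_iota k_gt0 add1n ltnS.
rewrite ev_flatten big_map big1_seq // => n /andP[_ /hdeg/andP[_ /eqP hn]].
by rewrite dsq_nil ?hn // /ev big_nil.
Qed.

(** A word acts with its first letter outermost. Leading letters Sq^0 act as the identity, and the
    first Sq^k with k > 0 is killed by psi, so only words in Sq^0 survive; these are what the
    augmentation counts. *)
Lemma ev_free_act psi x g : (forall k f, (0 < k)%N -> ev psi (Sq k f) = 0) ->
  ev psi (free_act x g) = free_aug x * ev psi g.
Proof.
move=> h; rewrite /free_aug /monalg.mmap /free_act raddf_sum mulr_suml.
apply: eq_bigr => m _ /=; rewrite evZ -mulrA; congr (_ * _).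
rewrite /free_aug_word /sq_word; elim: (m : seq nat) => [|[|k] s IHs] /=.
- by rewrite mul1r.
- by rewrite Sq0.
by rewrite h // mul0r.
Qed.

Lemma annihilates_hit N psi h : annihilates N psi -> h \in @hit d -> ev psi h = 0.
Proof.
move=> hpsi /asboolP[r hr ->]; rewrite raddf_sum big1_seq // => t /andP[_ /(allP hr)].
rewrite inE => /eqP aug0 /=; rewrite /A2_act ev_free_act; last first.
  by move=> k f; apply: annihilates_Sq hpsi.
by rewrite [free_aug _]aug0 mul0r.
Qed.

Lemma Sq_hit k g : (0 < k)%N -> Sq k g \in @hit d.
Proof.
move=> k_gt0; apply/asboolP; exists [:: (A2_sq k, g)]; first by rewrite /= A2_sq_plus k_gt0.
by rewrite big_seq1 A2_act_sq.
Qed.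

End Squares.

Definition permute (p s : seq nat) : seq nat := [seq nth 0%N s i | i <- p].

(* The monomials of x^s after the substitution x_0 |-> x_0 + x_1. *)
Definition transvect (s : seq nat) : seq (seq nat) :=
  if s is a :: b :: s' then
    [seq (a - t)%N :: (b + t)%N :: s' | t <- iota 0 (a + b).+1 & odd 'C(a, t)]
  else [:: s].

(* Transpose of transvect: the coefficient of x^n in the image of f is the sum of the
   coefficients of f at cotransvect n. *)
Definition cotransvect (n : seq nat) : seq (seq nat) :=
  if n is a :: b :: n' then
    [seq (a + t)%N :: (b - t)%N :: n'
    | t <- iota 0 (a + b).+1 & (t <= b)%N && odd 'C(a + t, t)]
  else [:: n].

(** The functional psi o w - psi for the transvection w; modulo 2 the difference is a
    concatenation. *)
Definition invariance_relation psi : seq (seq nat) := psi ++ flatten (map cotransvect psi).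

Lemma size_transvect s : all (fun t => size t == size s) (transvect s).
Proof. by case: s => [|a [|b s]] //=; rewrite ?eqxx //; apply/allP=> t /mapP[j _ ->]. Qed.

Lemma size_cotransvect s : all (fun t => size t == size s) (cotransvect s).
Proof. by case: s => [|a [|b s]] //=; rewrite ?eqxx //; apply/allP=> t /mapP[j _ ->]. Qed.

(** The sum of the first two exponents is preserved. If it differs for s and n, both counts are 0;
    otherwise both lists run over the same range of t and are compared for each t. *)
Lemma count_transvect s n : count_mem n (transvect s) = count_mem s (cotransvect n).
Proof.
have [e|ne] := eqVneq (size s) (size n); last first.
  rewrite !(count_memPn _) //; apply: contra ne.
    by move/(allP (size_cotransvect _))=> /eqP->.
  by move/(allP (size_transvect _))=> /eqP->.
case: s n e => [|a [|b s]] [|a' [|b' n]] // _; first by rewrite /= eq_sym.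
rewrite /transvect /cotransvect !count_map !count_filter.
have [<-|ne] := eqVneq (a + b)%N (a' + b')%N; last first.
  rewrite !(eq_count (a2 := pred0)) ?count_pred0 // => t /=; apply/negbTE.
    apply: contraNN ne => /andP[/eqP[<- <- _] /andP[le_tb _]].
    by rewrite addnAC -addnA subnK.
  apply: contraNN ne => /andP[/eqP[<- <- _]].
  have [le_ta _|lt_at] := leqP t a; last by rewrite bin_small.
  by rewrite [(b + t)%N]addnC addnA subnK.
apply: eq_count => t /=; rewrite !eqseq_cons [n == s]eq_sym.
have [le_ta|lt_at] := leqP t a; last first.
  rewrite bin_small // andbF; apply/esym/negbTE/negP=> /andP[/andP[/eqP e _] _].
  by rewrite -e ltnNge leq_addl in lt_at.
case: (s == n); rewrite ?andbT ?andbF //.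
have [e|ne] := eqVneq (a' + t)%N a; last first.
  by rewrite -(eqn_add2r t) subnK // eq_sym (negbTE ne).
rewrite -e addnK eqxx /=.
have [<-|ne] := eqVneq (b + t)%N b'; first by rewrite addnK eqxx leq_addl.
rewrite /=; apply/esym/negbTE; apply: contraNN ne => /andP[/eqP <- /andP[le_tb _]].
by rewrite subnK.
Qed.

(** * Permutations of variables and functionals vanishing on invariants *)

Section Invariants.
Variable d : nat.
Local Notation P := {mpoly 'F_2[d]}.
Implicit Types (s n p : seq nat) (psi : seq (seq nat)) (f g h : P).

Definition is_perm p : bool := perm_eq p (iota 0 d).

Lemma perm_of_seq p : is_perm p -> exists pi : 'S_d, forall i, pi i = nth 0%N p i :> nat.
Proof.
move=> hp; have sz : size p = d by rewrite (perm_size hp) size_iota.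
have lt i : (i < d)%N -> (nth 0 p i < d)%N.
  by move=> hi; have := mem_nth 0%N (s := p) (n := i); rewrite sz (perm_mem hp) mem_iota; apply.
have inj : injective (fun i : 'I_d => Ordinal (lt i (ltn_ord i))).
  have Up : uniq p by rewrite (perm_uniq hp) iota_uniq.
  move=> i j [e]; apply/val_inj/eqP.
  by rewrite -(nth_uniq 0%N _ _ Up) ?sz ?ltn_ord //; apply/eqP.
by exists (perm inj) => i; rewrite permE.
Qed.

Lemma mon_permute p (pi : 'S_d) s : is_perm p -> (forall i, pi i = nth 0%N p i :> nat) ->
  mon d (permute p s) = [multinom mon d s (pi i) | i < d].
Proof.
move=> hp hpi; apply/mnmP=> i; rewrite !mnmE (nth_map 0%N) ?hpi //.
by rewrite (perm_size hp) size_iota.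
Qed.

(** The transpose appears because [perm_mx pi] has its ones at (i, pi i), whereas [lin_subst] reads
    the image of x_i from column i. *)
Lemma msym_lin_subst (pi : 'S_d) f : msym pi f = lin_subst (perm_mx pi)^T f.
Proof.
elim/mpoly_ind_mul: f => [f g Hf Hg|c f Hf||i f Hf].
- by rewrite !raddfD /= Hf Hg.
- by rewrite msymZ lin_substZ Hf.
- by rewrite !rmorph1.
rewrite !rmorphM /= Hf lin_substX (bigD1 (pi i)) //= big1 => [|j ne]; last first.
  by rewrite !mxE eq_sym (negbTE ne) scale0r.
by rewrite !mxE eqxx scale1r addr0 /msym mmapX mmap1U.
Qed.

Lemma permute_hit p (r : seq (seq nat)) : is_perm p ->
  \sum_(s <- r) mono d s \in @hit d -> \sum_(s <- r) mono d (permute p s) \in @hit d.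
Proof.
move=> hp; have [pi hpi] := perm_of_seq hp.
(* [msym] acts on exponents through the inverse permutation, so pi^-1 is needed to obtain
   [permute p]. *)
move=> /(lin_subst_hit (perm_mx pi^-1)^T); rewrite -msym_lin_subst raddf_sum /=.
set f := (X in X \in _) => hf; set g := (X in X \in _); suff -> : g = f by [].
apply: eq_bigr => s _; rewrite msymX /mono (mon_permute s hp hpi).
by congr 'X_[_]; apply/mnmP=> i; rewrite !mnmE invgK.
Qed.

Definition hit_invariant f : Prop :=
  forall w, w \in unitmx -> lin_subst w f - f \in @hit d.

Lemma hit_invariant_subst w f : w \in unitmx -> hit_invariant f -> hit_invariant (lin_subst w f).
Proof.
move=> hw hf v hv; rewrite -lin_substM.
rewrite (_ : _ - _ = (lin_subst (v *m w) f - f) - (lin_subst w f - f)).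
  by rewrite rpredB ?hf // unitmx_mul hv.
by rewrite opprB addrA subrK.
Qed.

Definition vanishing psi : Prop := forall f, hit_invariant f -> ev psi f = 0.

(** The permuted functional at f is psi at the image of f under the permutation, and that image is
    again invariant. *)
Lemma vanishing_permute p psi : is_perm p -> vanishing psi -> vanishing (map (permute p) psi).
Proof.
move=> hp hpsi f hf; have [pi hpi] := perm_of_seq hp.
rewrite -(hpsi (lin_subst (perm_mx pi)^T f)); last first.
  by apply: hit_invariant_subst; rewrite // unitmx_tr unitmx_perm.
rewrite -msym_lin_subst /ev big_map; apply: eq_bigr => n _.
by rewrite mcoeff_sym (mon_permute n hp hpi).
Qed.

Lemma vanishing_flatten (r : seq (seq (seq nat))) :
  (forall psi, psi \in r -> vanishing psi) -> vanishing (flatten r).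
Proof.
by move=> hr f hf; rewrite ev_flatten big1_seq // => psi /andP[_ /hr]; apply.
Qed.

End Invariants.

(** * The transvection and the relations it yields *)

Section Transvection.
Variable d : nat.
Local Notation P := {mpoly 'F_2[d.+2]}.
Local Notation i0 := (ord0 : 'I_d.+2).
Local Notation i1 := (lift ord0 ord0 : 'I_d.+2).

Definition transvection : 'M['F_2]_d.+2 := 1%:M + delta_mx i1 i0.

(** It is an involution: the elementary matrix squares to zero and the cross terms cancel in
    characteristic 2. *)
Lemma transvection_unit : transvection \in unitmx.
Proof.
have e : transvection *m transvection = 1%:M.
  rewrite mulmxDl !mulmxDr !mulmx1 !mul1mx mul_delta_mx_0 // addr0 -addrA.
  rewrite (_ : delta_mx i1 i0 + delta_mx i1 i0 = 0) ?addr0 //.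
  by apply/matrixP=> i j; rewrite !mxE; exact: addF2.
by have [] := mulmx1_unit e.
Qed.

Lemma lin_subst_transvection (j : 'I_d.+2) :
  lin_subst transvection 'X_j = ('X_j + (if j == i0 then 'X_i1 else 0) : P).
Proof.
rewrite lin_substX (bigD1 j) //=; case: eqP => [->|/eqP ne].
  rewrite (bigD1 i1) //= big1 => [|i /andP[n0 n1]]; last first.
    by rewrite !mxE (negbTE n0) (negbTE n1) addr0 scale0r.
  by rewrite !mxE /= !addr0 add0r !scale1r.
rewrite big1 => [|i n0]; last by rewrite !mxE (negbTE n0) (negbTE ne) andbF addr0 scale0r.
by rewrite !mxE eqxx (negbTE ne) andbF !addr0 scale1r.
Qed.

Lemma transvection_mono s : size s = d.+2 ->
  lin_subst transvection (mono d.+2 s) = \sum_(t <- transvect s) mono d.+2 t.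
Proof.
have monoE a b s' : mono d.+2 (a :: b :: s') = 'X_i0 ^+ a * ('X_i1 ^+ b
    * \prod_(i < d) ('X_(lift ord0 (lift ord0 i)) : P) ^+ nth 0%N s' i).
  rewrite /mono mpolyXE_id !big_ord_recl !mnmE /=; congr (_ * (_ * _)).
  by apply: eq_bigr => i _; rewrite mnmE.
case: s => [|a [|b s]] // _; rewrite monoE [transvect _]/transvect big_map big_filter.
rewrite -[iota 0 _]/(index_iota 0 (a + b).+1) big_mkord.
rewrite !rmorphM /= !rmorphXn /= !lin_subst_transvection /= addr0 rmorph_prod /=.
under [X in _ * (_ * X)]eq_bigr do rewrite rmorphXn /= lin_subst_transvection /= addr0.
(* The binomial sum is extended from t <= a to the range used by [transvect]; the added terms have
   C(a, t) = 0. *)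
rewrite exprDn (big_ord_widen (a + b).+1
  (fun t => ('X_i0 : P) ^+ (a - t) * 'X_i1 ^+ t *+ 'C(a, t)));
  last by rewrite ltnS leq_addr.
rewrite big_mkcond mulr_suml [RHS]big_mkcond; apply: eq_bigr => t _.
case: ifP => [_|/negbT]; last first.
  by rewrite -leqNgt => lt_at; rewrite bin_small // mul0r.
rewrite mulrn_odd; case: odd; last by rewrite mul0r.
by rewrite monoE -mulrA [in RHS]exprD -!mulrA [X in _ * X]mulrCA.
Qed.

Lemma ev_transvection psi f : all (fun n => size n == d.+2) psi ->
  ev psi (lin_subst transvection f) = ev (flatten (map cotransvect psi)) f.
Proof.
move=> hpsi; apply: (ev_adjoint (fwd := transvect)) => //.
- exact: lin_substZ.
- exact: transvection_mono.
- by move=> s <-; exact: size_transvect.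
- by move=> s <-; exact: size_cotransvect.
exact: count_transvect.
Qed.

Lemma vanishing_invariance_relation N psi : annihilates d.+2 N psi ->
  vanishing d.+2 (invariance_relation psi).
Proof.
move=> hpsi f hf; rewrite ev_cat -ev_transvection; last first.
  by case/andP: hpsi => /allP hpsi _; apply/allP=> s /hpsi/andP[].
have := annihilates_hit hpsi (hf _ transvection_unit); rewrite raddfB /= => /eqP.
by rewrite subr_eq0 => /eqP->; exact: addF2.
Qed.

End Transvection.

(** * Enumeration of the monomials of a given degree *)

Fixpoint compositions (d n : nat) : seq (seq nat) :=
  if d is d'.+1 then flatten [seq map (cons a) (compositions d' (n - a)) | a <- iota 0 n.+1]
  else if n is 0 then [:: [::]] else [::].

Lemma count_compositions d n s :
  count_mem s (compositions d n) = ((size s == d) && (sumn s == n)).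
Proof.
elim: d n s => [|d IHd] n s; first by case: n => [|n]; case: s.
rewrite /compositions -/compositions count_flatten -map_comp sumnE big_map.
case: s => [|a s].
  rewrite big1 // => b _ /=; rewrite count_map (eq_count (a2 := pred0)) ?count_pred0 //.
rewrite (eq_bigr (fun b => (b == a) * count_mem s (compositions d (n - a)))%N); last first.
  by move=> b _; rewrite /= count_mem_cons_map; case: eqP => [->|].
rewrite -big_distrl /= IHd /= eqSS.
(* The head a occurs exactly once in [iota 0 n.+1] if a <= n, and not at all otherwise. *)
rewrite (_ : \sum_(b <- _) _ = (a <= n))%N; last first.
  rewrite -[RHS](_ : count_mem a (iota 0 n.+1) = _).
    by rewrite -sum1_count [RHS]big_mkcond.
  by rewrite count_uniq_mem ?iota_uniq // mem_iota add0n ltnS.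
have [le_an|lt_na] := leqP a n.
  by rewrite mul1n; congr (nat_of_bool (_ && _)); rewrite -(eqn_add2l a) subnKC.
by rewrite mul0n [(a + _ == n)%N]gtn_eqF ?andbF // (leq_trans lt_na) ?leq_addr.
Qed.

Section Compositions.
Variable d : nat.
Local Notation P := {mpoly 'F_2[d]}.

Lemma homog_compositions n (f : P) : f \is n.-homog ->
  f = \sum_(s <- compositions d n) f@_(mon d s) *: mono d s.
Proof.
move=> /dhomogP hf; apply/mpolyP=> m; have [s hs em] := mon_surj m.
rewrite raddf_sum (eq_big_seq (fun t => f@_m *+ (t == s))) => [|t ht] /=; last first.
  have /eqP ht_d : size t == d.
    have : (0 < count_mem t (compositions d n))%N by rewrite -has_count has_pred1.
    by rewrite count_compositions; case: eqP.
  by rewrite mcoeffZ em mono_coef //; case: eqP => [->|_]; rewrite ?mulr1 ?mulr0.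
have [hm|] := eqVneq (sumn s) n.
  rewrite (_ : \sum_(t <- _) _ = f@_m *+ count_mem s (compositions d n)).
    by rewrite count_compositions hs hm !eqxx.
  by rewrite sumrMnr -sum1_count [in RHS]big_mkcond.
move=> ne; rewrite big1_seq => [|t /andP[_ ht]]; last first.
  have : (0 < count_mem t (compositions d n))%N by rewrite -has_count has_pred1.
  rewrite count_compositions; case: (t =P s) => [->|//].
  by rewrite (negbTE ne) andbF.
have em2 : mdeg (mon d s) = sumn s.
  rewrite mdegE sumnE (big_nth 0%N) big_mkord hs; apply: eq_bigr => i _.
  by rewrite mnmE.
by apply: memN_msupp_eq0; apply: contra ne => /hf <-; rewrite -em2 em.
Qed.

End Compositions.

(** * Explicit data in degree 8 and its verification *)

(* Each entry psi is the functional adding the coefficients of the listed monomials; it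
   annihilates the hit polynomials. *)
Definition psis : seq (seq (seq nat)) := [::
  [:: [:: 0; 1; 7; 0; 0]];
  [:: [:: 4; 1; 3; 0; 0]; [:: 3; 2; 3; 0; 0]; [:: 2; 1; 5; 0; 0]; [:: 1; 1; 6; 0; 0]];
  [:: [:: 0; 4; 1; 3; 0]; [:: 0; 3; 2; 3; 0]; [:: 0; 2; 1; 5; 0]; [:: 0; 1; 1; 6; 0]];
  [:: [:: 1; 3; 1; 3; 0]];
  [:: [:: 0; 5; 1; 1; 1]; [:: 0; 3; 2; 2; 1]; [:: 0; 3; 2; 1; 2]; [:: 0; 3; 1; 2; 2]];
  [:: [:: 0; 4; 1; 2; 1]; [:: 0; 4; 1; 1; 2]; [:: 0; 3; 2; 2; 1]; [:: 0; 3; 2; 1; 2];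
     [:: 0; 2; 1; 4; 1]; [:: 0; 2; 1; 3; 2]; [:: 0; 2; 1; 2; 3]; [:: 0; 2; 1; 1; 4];
     [:: 0; 1; 1; 5; 1]; [:: 0; 1; 1; 4; 2]; [:: 0; 1; 1; 2; 4]; [:: 0; 1; 1; 1; 5]];
  [:: [:: 2; 3; 1; 1; 1]; [:: 1; 3; 1; 1; 2]];
  [:: [:: 4; 1; 1; 1; 1]; [:: 3; 1; 1; 1; 2]; [:: 2; 1; 2; 2; 1]; [:: 2; 1; 2; 1; 2];
     [:: 2; 1; 1; 2; 2]; [:: 1; 1; 4; 1; 1]; [:: 1; 1; 3; 1; 2]; [:: 1; 1; 2; 2; 2];
     [:: 1; 1; 1; 4; 1]; [:: 1; 1; 1; 3; 2]; [:: 1; 1; 1; 2; 3]; [:: 1; 1; 1; 1; 4]]]%N.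

(* An entry (s, c) asserts that x^s plus the sum of the Sq^k(x^g), for (k, g) in c, is a
   sum of basis monomials; exponents of absent variables are omitted. The monomials that are
   not listed are the chosen basis of the quotient. *)
Definition hit_table : seq (seq nat * seq (nat * seq nat)) := [::
  ([:: 8], [:: (4, [:: 4])]);
  ([:: 2; 6], [:: (1, [:: 2; 5])]);
  ([:: 4; 4], [:: (1, [:: 4; 3])]);
  ([:: 5; 3], [:: (1, [:: 4; 3]); (2, [:: 3; 3])]);
  ([:: 6; 2], [:: (1, [:: 6; 1])]);
  ([:: 2; 1; 5], [:: (1, [:: 1; 1; 5])]);
  ([:: 2; 5; 1], [:: (1, [:: 1; 5; 1])]);
  ([:: 5; 2; 1], [:: (1, [:: 5; 1; 1])]);
  ([:: 1; 3; 4], [:: (1, [:: 2; 4; 1]); (2, [:: 1; 3; 2])]);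
  ([:: 1; 4; 3], [:: (1, [:: 2; 2; 3]); (2, [:: 1; 2; 3])]);
  ([:: 2; 2; 4], [:: (1, [:: 2; 2; 3])]);
  ([:: 2; 4; 2], [:: (1, [:: 2; 4; 1])]);
  ([:: 3; 1; 4], [:: (1, [:: 4; 2; 1]); (2, [:: 3; 1; 2])]);
  ([:: 3; 4; 1], [:: (2, [:: 3; 2; 1]); (3, [:: 3; 1; 1])]);
  ([:: 4; 1; 3], [:: (2, [:: 2; 1; 3]); (3, [:: 1; 1; 3])]);
  ([:: 4; 2; 2], [:: (1, [:: 4; 2; 1])]);
  ([:: 4; 3; 1], [:: (2, [:: 2; 3; 1]); (3, [:: 1; 3; 1])]);
  ([:: 2; 3; 3], [:: (1, [:: 1; 3; 3]); (2, [:: 1; 2; 3]); (2, [:: 1; 3; 2]);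
     (3, [:: 1; 2; 2])]);
  ([:: 3; 2; 3], [:: (1, [:: 3; 1; 3]); (1, [:: 4; 2; 1]); (2, [:: 2; 1; 3]); (2, [:: 3; 1; 2]);
     (3, [:: 1; 1; 3])]);
  ([:: 3; 3; 2], [:: (1, [:: 3; 3; 1]); (2, [:: 2; 3; 1]); (2, [:: 3; 2; 1]); (3, [:: 1; 3; 1]);
     (3, [:: 3; 1; 1])]);
  ([:: 1; 1; 4; 2], [:: (1, [:: 2; 2; 2; 1]); (2, [:: 1; 1; 2; 2])]);
  ([:: 1; 4; 1; 2], [:: (1, [:: 2; 2; 2; 1]); (2, [:: 1; 2; 1; 2])]);
  ([:: 1; 4; 2; 1], [:: (1, [:: 2; 2; 2; 1]); (2, [:: 1; 2; 2; 1])]);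
  ([:: 2; 1; 1; 4], [:: (1, [:: 1; 1; 1; 4])]);
  ([:: 2; 1; 4; 1], [:: (2, [:: 1; 1; 2; 2]); (3, [:: 1; 1; 2; 1])]);
  ([:: 2; 4; 1; 1], [:: (1, [:: 1; 4; 1; 1]); (2, [:: 1; 2; 1; 2]); (2, [:: 1; 2; 2; 1])]);
  ([:: 4; 1; 1; 2], [:: (2, [:: 2; 1; 1; 2]); (3, [:: 1; 1; 1; 2])]);
  ([:: 4; 1; 2; 1], [:: (1, [:: 1; 1; 4; 1]); (2, [:: 1; 1; 2; 2]); (2, [:: 2; 1; 2; 1])]);
  ([:: 4; 2; 1; 1], [:: (2, [:: 1; 2; 1; 2]); (2, [:: 1; 2; 2; 1]); (2, [:: 2; 2; 1; 1]);
     (3, [:: 1; 2; 1; 1])]);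
  ([:: 1; 2; 2; 3], [:: (1, [:: 2; 1; 1; 3]); (2, [:: 1; 1; 1; 3])]);
  ([:: 1; 2; 3; 2], [:: (1, [:: 2; 1; 3; 1]); (1, [:: 2; 2; 2; 1]); (2, [:: 1; 1; 2; 2]);
     (2, [:: 1; 1; 3; 1])]);
  ([:: 1; 3; 2; 2], [:: (1, [:: 2; 3; 1; 1]); (2, [:: 1; 2; 1; 2]); (2, [:: 1; 2; 2; 1]);
     (2, [:: 1; 3; 1; 1])]);
  ([:: 2; 1; 2; 3], [:: (1, [:: 1; 1; 2; 3]); (1, [:: 2; 1; 1; 3]); (2, [:: 1; 1; 1; 3])]);
  ([:: 2; 1; 3; 2], [:: (1, [:: 1; 1; 3; 2]); (1, [:: 2; 1; 3; 1]); (2, [:: 1; 1; 3; 1])]);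
  ([:: 2; 2; 1; 3], [:: (1, [:: 1; 2; 1; 3]); (1, [:: 2; 1; 1; 3]); (2, [:: 1; 1; 1; 3])]);
  ([:: 2; 2; 3; 1], [:: (1, [:: 1; 1; 3; 2]); (2, [:: 1; 1; 2; 2]); (2, [:: 1; 1; 3; 1]);
     (3, [:: 1; 1; 2; 1])]);
  ([:: 2; 3; 1; 2], [:: (1, [:: 1; 3; 2; 1]); (2, [:: 1; 2; 2; 1]); (2, [:: 1; 3; 1; 1]);
     (3, [:: 1; 2; 1; 1])]);
  ([:: 2; 3; 2; 1], [:: (1, [:: 1; 3; 1; 2]); (2, [:: 1; 2; 1; 2]); (2, [:: 1; 3; 1; 1]);
     (3, [:: 1; 2; 1; 1])]);
  ([:: 3; 1; 2; 2], [:: (1, [:: 3; 2; 1; 1]); (1, [:: 4; 1; 1; 1]); (2, [:: 1; 2; 1; 2]);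
     (2, [:: 1; 2; 2; 1]); (2, [:: 2; 2; 1; 1]); (2, [:: 3; 1; 1; 1]); (3, [:: 1; 2; 1; 1])]);
  ([:: 3; 2; 1; 2], [:: (1, [:: 1; 1; 4; 1]); (1, [:: 3; 1; 2; 1]); (1, [:: 4; 1; 1; 1]);
     (2, [:: 1; 1; 2; 2]); (2, [:: 2; 1; 2; 1]); (2, [:: 3; 1; 1; 1])]);
  ([:: 3; 2; 2; 1], [:: (1, [:: 3; 1; 1; 2]); (1, [:: 4; 1; 1; 1]); (2, [:: 2; 1; 1; 2]);
     (2, [:: 3; 1; 1; 1]); (3, [:: 1; 1; 1; 2])]);
  ([:: 2; 2; 2; 2], [:: (1, [:: 2; 2; 2; 1])]);
  ([:: 4; 1; 1; 1; 1], [:: (2, [:: 1; 1; 1; 1; 2]); (2, [:: 1; 1; 1; 2; 1]);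
     (2, [:: 1; 1; 2; 1; 1]); (2, [:: 1; 2; 1; 1; 1]); (2, [:: 2; 1; 1; 1; 1]);
     (3, [:: 1; 1; 1; 1; 1])]);
  ([:: 2; 1; 1; 1; 3], [:: (1, [:: 1; 1; 1; 1; 3])]);
  ([:: 2; 1; 1; 3; 1], [:: (1, [:: 1; 1; 1; 3; 1])]);
  ([:: 2; 1; 3; 1; 1], [:: (1, [:: 1; 1; 3; 1; 1])]);
  ([:: 2; 3; 1; 1; 1], [:: (1, [:: 1; 3; 1; 1; 1])]);
  ([:: 3; 2; 1; 1; 1], [:: (1, [:: 3; 1; 1; 1; 1]); (2, [:: 1; 1; 1; 1; 2]);
     (2, [:: 1; 1; 1; 2; 1]); (2, [:: 1; 1; 2; 1; 1]); (2, [:: 1; 2; 1; 1; 1]);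
     (2, [:: 2; 1; 1; 1; 1]); (3, [:: 1; 1; 1; 1; 1])]);
  ([:: 1; 1; 2; 2; 2], [:: (1, [:: 2; 2; 1; 1; 1]); (2, [:: 1; 1; 1; 1; 2]);
     (2, [:: 1; 1; 1; 2; 1]); (2, [:: 1; 1; 2; 1; 1])]);
  ([:: 1; 2; 1; 2; 2], [:: (1, [:: 2; 1; 2; 1; 1]); (2, [:: 1; 1; 1; 1; 2]);
     (2, [:: 1; 1; 1; 2; 1]); (2, [:: 1; 2; 1; 1; 1])]);
  ([:: 1; 2; 2; 1; 2], [:: (1, [:: 2; 1; 1; 2; 1]); (2, [:: 1; 1; 1; 1; 2]);
     (2, [:: 1; 1; 2; 1; 1]); (2, [:: 1; 2; 1; 1; 1])]);
  ([:: 1; 2; 2; 2; 1], [:: (1, [:: 2; 1; 1; 1; 2]); (2, [:: 1; 1; 1; 2; 1]);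
     (2, [:: 1; 1; 2; 1; 1]); (2, [:: 1; 2; 1; 1; 1])]);
  ([:: 2; 1; 1; 2; 2], [:: (1, [:: 1; 2; 2; 1; 1]); (2, [:: 1; 1; 2; 1; 1]);
     (2, [:: 1; 2; 1; 1; 1]); (3, [:: 1; 1; 1; 1; 1])]);
  ([:: 2; 1; 2; 1; 2], [:: (1, [:: 1; 2; 1; 2; 1]); (2, [:: 1; 1; 1; 2; 1]);
     (2, [:: 1; 2; 1; 1; 1]); (3, [:: 1; 1; 1; 1; 1])]);
  ([:: 2; 1; 2; 2; 1], [:: (1, [:: 1; 2; 1; 1; 2]); (2, [:: 1; 1; 1; 1; 2]);
     (2, [:: 1; 2; 1; 1; 1]); (3, [:: 1; 1; 1; 1; 1])]);
  ([:: 2; 2; 1; 1; 2], [:: (1, [:: 1; 1; 2; 2; 1]); (2, [:: 1; 1; 1; 2; 1]);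
     (2, [:: 1; 1; 2; 1; 1]); (3, [:: 1; 1; 1; 1; 1])]);
  ([:: 2; 2; 1; 2; 1], [:: (1, [:: 1; 1; 2; 1; 2]); (2, [:: 1; 1; 1; 1; 2]);
     (2, [:: 1; 1; 2; 1; 1]); (3, [:: 1; 1; 1; 1; 1])]);
  ([:: 2; 2; 2; 1; 1], [:: (1, [:: 1; 1; 1; 2; 2]); (2, [:: 1; 1; 1; 1; 2]);
     (2, [:: 1; 1; 1; 2; 1]); (3, [:: 1; 1; 1; 1; 1])])]%N.

(* An entry (s, c) writes the coordinate functional of the basis monomial x^s as the sum,
   for (p, i) in c, of the relation of psi_i with its positions permuted by p. *)
Definition vanishing_table : seq (seq nat * seq (seq nat * nat)) := [::
  ([:: 1; 7], [:: ([:: 0; 2; 1; 3; 4], 0)]);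
  ([:: 3; 5], [:: ([:: 0; 2; 1; 3; 4], 1)]);
  ([:: 7; 1], [:: ([:: 2; 0; 1; 3; 4], 0)]);
  ([:: 1; 1; 6], [:: ([:: 0; 1; 3; 2; 4], 3); ([:: 0; 2; 3; 1; 4], 2); ([:: 2; 3; 0; 4; 1], 7);
     ([:: 1; 2; 0; 3; 4], 3)]);
  ([:: 1; 6; 1], [:: ([:: 0; 3; 1; 2; 4], 3); ([:: 0; 3; 2; 1; 4], 2); ([:: 2; 0; 3; 4; 1], 7);
     ([:: 1; 0; 2; 3; 4], 3)]);
  ([:: 6; 1; 1], [:: ([:: 0; 1; 2; 3; 4], 3); ([:: 3; 0; 2; 1; 4], 2); ([:: 0; 2; 3; 4; 1], 7);
     ([:: 0; 3; 1; 2; 4], 3)]);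
  ([:: 1; 2; 5], [:: ([:: 2; 0; 3; 1; 4], 2); ([:: 0; 2; 3; 1; 4], 2); ([:: 1; 0; 3; 2; 4], 3);
     ([:: 0; 1; 3; 2; 4], 3)]);
  ([:: 1; 5; 2], [:: ([:: 2; 3; 0; 1; 4], 2); ([:: 0; 3; 2; 1; 4], 2); ([:: 1; 0; 3; 2; 4], 3);
     ([:: 0; 3; 1; 2; 4], 3)]);
  ([:: 5; 1; 2], [:: ([:: 3; 2; 0; 1; 4], 2); ([:: 3; 0; 2; 1; 4], 2); ([:: 0; 3; 1; 2; 4], 3);
     ([:: 0; 1; 3; 2; 4], 3)]);
  ([:: 1; 1; 1; 5], [:: ([:: 2; 3; 4; 0; 1], 7)]);
  ([:: 1; 1; 5; 1], [:: ([:: 2; 3; 0; 4; 1], 7)]);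
  ([:: 1; 5; 1; 1], [:: ([:: 2; 0; 3; 4; 1], 7)]);
  ([:: 5; 1; 1; 1], [:: ([:: 0; 2; 3; 4; 1], 7)]);
  ([:: 1; 1; 2; 4], [:: ([:: 3; 2; 0; 4; 1], 5); ([:: 0; 2; 3; 4; 1], 5);
     ([:: 3; 2; 4; 0; 1], 5)]);
  ([:: 1; 2; 1; 4], [:: ([:: 3; 0; 2; 4; 1], 5); ([:: 0; 3; 2; 4; 1], 5);
     ([:: 3; 4; 2; 0; 1], 5)]);
  ([:: 1; 2; 4; 1], [:: ([:: 3; 0; 4; 2; 1], 5); ([:: 0; 3; 4; 2; 1], 5);
     ([:: 3; 4; 0; 2; 1], 5)]);
  ([:: 1; 1; 3; 3], [:: ([:: 1; 2; 0; 3; 4], 3)]);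
  ([:: 1; 3; 1; 3], [:: ([:: 1; 0; 2; 3; 4], 3)]);
  ([:: 1; 3; 3; 1], [:: ([:: 1; 0; 3; 2; 4], 3)]);
  ([:: 3; 1; 1; 3], [:: ([:: 0; 1; 2; 3; 4], 3)]);
  ([:: 3; 1; 3; 1], [:: ([:: 0; 1; 3; 2; 4], 3)]);
  ([:: 3; 3; 1; 1], [:: ([:: 0; 3; 1; 2; 4], 3)]);
  ([:: 1; 1; 1; 1; 4], [:: ([:: 0; 1; 2; 3; 4], 6); ([:: 0; 2; 3; 4; 1], 4);
     ([:: 0; 2; 3; 4; 1], 7)]);
  ([:: 1; 1; 1; 4; 1], [:: ([:: 0; 1; 2; 4; 3], 6); ([:: 0; 2; 3; 1; 4], 4);
     ([:: 0; 2; 3; 1; 4], 7)]);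
  ([:: 1; 1; 4; 1; 1], [:: ([:: 0; 1; 4; 2; 3], 6); ([:: 0; 2; 1; 3; 4], 4);
     ([:: 0; 2; 1; 3; 4], 7)]);
  ([:: 1; 4; 1; 1; 1], [:: ([:: 0; 1; 2; 3; 4], 4); ([:: 0; 1; 2; 3; 4], 7)]);
  ([:: 1; 1; 1; 2; 3], [:: ([:: 1; 2; 3; 4; 0], 6)]);
  ([:: 1; 1; 1; 3; 2], [:: ([:: 1; 2; 3; 0; 4], 6)]);
  ([:: 1; 1; 2; 1; 3], [:: ([:: 1; 2; 4; 3; 0], 6)]);
  ([:: 1; 1; 2; 3; 1], [:: ([:: 1; 2; 4; 0; 3], 6)]);
  ([:: 1; 1; 3; 1; 2], [:: ([:: 1; 2; 0; 3; 4], 6)]);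
  ([:: 1; 1; 3; 2; 1], [:: ([:: 1; 2; 0; 4; 3], 6)]);
  ([:: 1; 2; 1; 1; 3], [:: ([:: 1; 4; 2; 3; 0], 6)]);
  ([:: 1; 2; 1; 3; 1], [:: ([:: 1; 4; 2; 0; 3], 6)]);
  ([:: 1; 2; 3; 1; 1], [:: ([:: 1; 4; 0; 2; 3], 6)]);
  ([:: 1; 3; 1; 1; 2], [:: ([:: 1; 0; 2; 3; 4], 6)]);
  ([:: 1; 3; 1; 2; 1], [:: ([:: 1; 0; 2; 4; 3], 6)]);
  ([:: 1; 3; 2; 1; 1], [:: ([:: 1; 0; 4; 2; 3], 6)]);
  ([:: 3; 1; 1; 1; 2], [:: ([:: 0; 1; 2; 3; 4], 6)]);
  ([:: 3; 1; 1; 2; 1], [:: ([:: 0; 1; 2; 4; 3], 6)]);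
  ([:: 3; 1; 2; 1; 1], [:: ([:: 0; 1; 4; 2; 3], 6)])]%N.

Definition pad (s : seq nat) : seq nat := s ++ nseq (5 - size s) 0%N.

Definition hits_of (s : seq nat) : seq (nat * seq nat) :=
  flatten [seq e.2 | e <- hit_table & e.1 == s].

(** A formal sum congruent to x^s modulo hit polynomials. For a basis monomial [hits_of] is empty
    and only x^s remains. *)
Definition reduce (s : seq nat) : seq (seq nat) :=
  pad s :: flatten [seq sqs e.1 (pad e.2) | e <- hits_of s].

Definition positive_compositions (k : nat) : seq (seq nat) :=
  [seq s <- compositions k 8 | all (leq 1) s].

(** A pair (n, t) stands for the tensor of the coefficient functional at x^n with the monomial
    x^t. *)
Definition reduction_pairs (k : nat) : seq (seq nat * seq nat) :=
  flatten [seq [seq (pad s, t) | t <- reduce s] | s <- positive_compositions k].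

Definition expand (c : seq (seq nat * nat)) : seq (seq nat) :=
  flatten [seq map (permute e.1) (invariance_relation (nth [::] psis e.2)) | e <- c].

Definition vanishing_pairs (k : nat) : seq (seq nat * seq nat) :=
  flatten [seq [seq (n, pad e.1) | n <- expand e.2] | e <- vanishing_table & size e.1 == k].

Fixpoint masks (d : nat) : seq bitseq :=
  if d is d'.+1 then map (cons true) (masks d') ++ map (cons false) (masks d') else [:: [::]].

(* Permuting by mask_perm b moves the first k entries, in order, to the k positions set in b. *)
Definition mask_perm (b : bitseq) : seq nat :=
  let o := mask b (iota 0 5) ++ mask (map negb b) (iota 0 5) in
  [seq index i o | i <- iota 0 5].

Definition support_size (b : bitseq) : nat := count id b.

Definition spread_compositions : seq (seq nat) :=
  flatten [seq [seq permute (mask_perm b) (pad s) | s <- positive_compositions (support_size b)]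
          | b <- masks 5].

Lemma psis_annihilates : all (annihilates 5 8) psis.
Proof. by vm_compute. Qed.

Lemma hit_table_valid :
  all (fun e => all (fun c => (0 < c.1)%N && (size (pad c.2) == 5%N)) e.2) hit_table.
Proof. by vm_compute. Qed.

Lemma vanishing_table_valid :
  all (fun e => all (fun c => is_perm 5 c.1 && (c.2 < size psis)%N) e.2) vanishing_table.
Proof. by vm_compute. Qed.

Lemma masks_valid :
  all (fun b => is_perm 5 (mask_perm b) && (support_size b < 6)%N) (masks 5).
Proof. by vm_compute. Qed.

(* In terms of tensors: the sum of m (x) reduce(m) over the monomials m equals the sum of
   phi_s (x) s over the basis monomials s, with phi_s the coordinate functional of s. *)
Lemma reduction_pairs_even :
  all (fun k => even_mult (reduction_pairs k ++ vanishing_pairs k)) (iota 0 6).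
Proof. by vm_compute. Qed.

(** A monomial is determined by its support and its positive exponents, so each one appears once in
    either list. *)
Lemma spread_compositions_even : even_mult (compositions 5 8 ++ spread_compositions).
Proof. by vm_compute. Qed.

(** * From the verified data to the vanishing of invariants *)

Lemma hitZ (d : nat) (c : 'F_2) (h : {mpoly 'F_2[d]}) : h \in @hit d -> c *: h \in @hit d.
Proof.
case: c => [[|[|//]] i] hh; last by rewrite (_ : Ordinal i = 1) ?scale1r //; apply/val_inj.
by rewrite (_ : Ordinal i = 0) ?scale0r ?rpred0 //; apply/val_inj.
Qed.

Lemma all_flatten_filter (T U : Type) (Q : pred U) (q : pred T) (F : T -> seq U) (l : seq T) :
  all (fun e => all Q (F e)) l -> all Q (flatten [seq F e | e <- l & q e]).
Proof.
by elim: l => //= e l IHl /andP[he /IHl hl]; case: ifP; rewrite //= all_cat he.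
Qed.

Lemma hits_of_valid s :
  all (fun c => (0 < c.1)%N && (size (pad c.2) == 5%N)) (hits_of s).
Proof.
exact: (@all_flatten_filter _ _ (fun c => (0 < c.1)%N && (size (pad c.2) == 5%N))
          (fun e => e.1 == s) snd hit_table hit_table_valid).
Qed.

Lemma mono_reduce_hit p s : is_perm 5 p ->
  \sum_(t <- reduce s) mono 5 (permute p t) - mono 5 (permute p (pad s)) \in @hit 5.
Proof.
move=> hp; rewrite big_cons addrAC subrr add0r; apply: permute_hit => //.
rewrite big_flatten big_map big_seq; apply: rpred_sum => e.
move/(allP (hits_of_valid s)) => /andP[k_gt0 /eqP hsz].
by rewrite -(Sq_mono _ hsz); apply: Sq_hit.
Qed.

Lemma vanishing_expand e : e \in vanishing_table -> vanishing 5 (expand e.2).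
Proof.
move=> /(allP vanishing_table_valid)/allP he; apply: vanishing_flatten => _ /mapP[c hc ->].
have /andP[hp hi] := he _ hc; apply: vanishing_permute => //.
(* Here 3 is the number of variables other than the two that the transvection involves. *)
by apply: (@vanishing_invariance_relation 3 8); apply: (allP psis_annihilates); apply: mem_nth.
Qed.

(** The tensor identity is evaluated at f after permuting the variables by p. On the basis side each
    term carries a coordinate functional, which vanishes on invariants; on the other side the sum
    differs from the given one by a hit polynomial. *)
Lemma hit_spread_part (f : {mpoly 'F_2[5]}) k p : hit_invariant f -> is_perm 5 p -> (k < 6)%N ->
  \sum_(s <- positive_compositions k)
     f@_(mon 5 (permute p (pad s))) *: mono 5 (permute p (pad s)) \in @hit 5.
Proof.
move=> hf hp hk.
pose G (x : seq nat * seq nat) := f@_(mon 5 (permute p x.1)) *: mono 5 (permute p x.2).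
have sumG : \sum_(x <- reduction_pairs k) G x = 0.
  rewrite (@sum_even_mult_cat _ _ G _ (vanishing_pairs k) (@addff 5)); last first.
    by apply: (allP reduction_pairs_even); rewrite mem_iota.
  (* For a fixed basis monomial the coefficients add up to its coordinate functional at f, which is
     0. *)
  rewrite big_flatten big_map big1_seq // => e /andP[_]; rewrite mem_filter => /andP[_ he].
  rewrite big_map /G /= -scaler_suml.
  have := vanishing_permute hp (vanishing_expand he) hf; rewrite /ev big_map => ->.
  by rewrite scale0r.
set A := (X in X \in _); suff : \sum_(x <- reduction_pairs k) G x - A \in @hit 5.
  by rewrite sumG sub0r rpredN.
rewrite big_flatten big_map -sumrB.
apply: rpred_sum => s _; rewrite big_map /G /= -scaler_sumr -scalerBr.
exact/hitZ/mono_reduce_hit.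
Qed.

Theorem proposition4p1p1 (u : QP 5) : QP_GL_invariant 8 u <-> u = 0.
Proof.
split=> [[[f f_homog ->] inv_u]|->]; last first.
  split=> [|w _]; last by rewrite -(raddf0 (@QP_class 5)) QP_act_class !raddf0.
  by exists 0; [exact: rpred0 | rewrite raddf0].
rewrite -(raddf0 (@QP_class 5)); apply/QP_eqP; rewrite subr0.
have hf : hit_invariant f.
  by move=> w /inv_u; rewrite QP_act_class => /QP_eqP.
rewrite (homog_compositions f_homog).
(* The monomials of f are regrouped by support, each support being treated separately. *)
rewrite (@sum_even_mult_cat _ _ _ _ spread_compositions (@addff 5)); last first.
  exact: spread_compositions_even.
rewrite big_flatten big_map big_seq; apply: rpred_sum => b /(allP masks_valid)/andP[hp hk].
by rewrite big_map; apply: hit_spread_part.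
Qed.
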